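(* Let $\alpha\in[0,1]$. (a) Let $G_1$ and $G_2$ be regular graphs and let $H$ be an arbitrary graph. If $G_1$ and $G_2$ are $A_\alpha$-cospectral, then $G_1\dot\vee_T H$ and $G_2\dot\vee_T H$ are $A_\alpha$-cospectral. (b) Let $G$ be a regular graph and let $H_1$ and $H_2$ be graphs with $\Upsilon_{A_\alpha(H_1)}(\nu)=\Upsilon_{A_\alpha(H_2)}(\nu)$. If $H_1$ and $H_2$ are $A_\alpha$-cospectral, then $G\dot\vee_T H_1$ and $G\dot\vee_T H_2$ are $A_\alpha$-cospectral.
   Context: All graphs are finite, undirected and simple. For a graph $G$ with adjacency matrix $A(G)$ and diagonal degree matrix $D(G)$, put $A_\alpha(G)=\alpha D(G)+(1-\alpha)A(G)$. The $A_\alpha$-spectrum of $G$ is the multiset of eigenvalues of $A_\alpha(G)$. Two non-isomorphic graphs possessing the same $A_\alpha$-spectrum are called $A_\alpha$-cospectral. For an $n\times n$ matrix $M$, the $M$-coronal is the rational function $\Upsilon_M(\nu)=\mathbf 1_n^T(\nu I_n-M)^{-1}\mathbf 1_n$, where $\mathbf 1_n$ is the all-ones column vector. The total graph $T(G)$ is obtained from $G$ (keeping all its vertices and edges) by adding one new vertex for every edge of $G$, making each new vertex adjacent to the two end vertices of the corresponding edge, and making two new vertices adjacent whenever their corresponding (distinct) edges share an endpoint in $G$. The $T$-vertex join $G_1\dot\vee_T G_2$ is obtained from the disjoint union of $T(G_1)$ and $G_2$ by joining each original vertex of $G_1$ in $T(G_1)$ to every vertex of $G_2$. *)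

(* Defs.v *)
From HB Require Import structures.
From mathcomp Require Import all_boot all_order all_algebra.
From mathcomp Require Import reals.

Set Implicit Arguments.
Unset Strict Implicit.
Unset Printing Implicit Defensive.

Import Order.TTheory GRing.Theory Num.Theory.
Local Open Scope ring_scope.

Record sgraph := SGraph {
  vertex :> finType;
  adj : rel vertex;
  adj_sym : symmetric adj;
  adj_irrefl : irreflexive adj
}.

Definition degree (G : sgraph) (x : G) : nat := #|[set y | adj x y]|.

Definition regular (G : sgraph) : Prop :=
  exists r : nat, forall x : G, degree x = r.

Definition isomorphic (G H : sgraph) : Prop :=
  exists2 f : G -> H, bijective f & {mono f : x y / adj x y}.

Definition edges (G : sgraph) : {set {set G}} :=
  [set [set p.1; p.2] | p : G * G & adj p.1 p.2].

Definition edge (G : sgraph) : finType := {e : {set G} | e \in edges G}.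

Section TotalGraph.
Variable G : sgraph.

Definition total_adj (a b : G + edge G) : bool :=
  match a, b with
  | inl x, inl y => adj x y
  | inl x, inr e => x \in val e
  | inr e, inl x => x \in val e
  | inr e, inr f => (e != f) && (val e :&: val f != set0)
  end.

Lemma total_adj_sym : symmetric total_adj.
Proof. by move=> [x|e] [y|f] //=; [rewrite adj_sym | rewrite eq_sym setIC]. Qed.

Lemma total_adj_irrefl : irreflexive total_adj.
Proof. by move=> [x|e] /=; rewrite ?adj_irrefl ?eqxx. Qed.

Definition total_graph : sgraph := SGraph total_adj_sym total_adj_irrefl.

End TotalGraph.

Section TVertexJoin.
Variables G1 G2 : sgraph.

Definition tvjoin_adj (a b : total_graph G1 + G2) : bool :=
  match a, b with
  | inl s, inl t => adj s t
  | inr x, inr y => adj x y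
  | inl s, inr _ | inr _, inl s => if s is inl _ then true else false
  end.

Lemma tvjoin_adj_sym : symmetric tvjoin_adj.
Proof. by move=> [s|x] [t|y] //; apply: adj_sym. Qed.

Lemma tvjoin_adj_irrefl : irreflexive tvjoin_adj.
Proof. by move=> [s|x]; apply: adj_irrefl. Qed.

Definition tvjoin : sgraph := SGraph tvjoin_adj_sym tvjoin_adj_irrefl.

End TVertexJoin.

Section Spectra.
Variable R : realType.

(* Rows and columns are indexed by the enumeration of the vertices. *)
Definition adj_mx (G : sgraph) : 'M[R]_#|G| :=
  \matrix_(i, j) (adj (enum_val i) (enum_val j))%:R.

Definition degree_mx (G : sgraph) : 'M[R]_#|G| :=
  diag_mx (\row_i (degree (enum_val i))%:R).

Definition Aalpha_mx (alpha : R) (G : sgraph) : 'M[R]_#|G| :=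
  alpha *: degree_mx G + (1 - alpha) *: adj_mx G.

(* The multiset of eigenvalues in R, as a multiplicity function: an element
   which is not an eigenvalue gets 0.  No eigenvalue is lost by staying in R
   for the matrices Aalpha_mx alpha G, since they are symmetric. *)
Definition spectrum n (M : 'M[R]_n) : R -> nat :=
  fun lambda => mup lambda (char_poly M).

Definition Aalpha_cospectral (alpha : R) (G H : sgraph) : Prop :=
  ~ isomorphic G H /\
  spectrum (Aalpha_mx alpha G) =1 spectrum (Aalpha_mx alpha H).

(* The indeterminate nu is 'X, and char_poly_mx M is 'X%:M - M over {poly R};
   it is inverted over the field of rational functions, where its determinant
   char_poly M is nonzero. *)
Definition coronal n (M : 'M[R]_n) : {fraction {poly R}} :=
  ((const_mx 1 : 'rV_n) *m invmx (map_mx (@tofrac _) (char_poly_mx M))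
     *m (const_mx 1 : 'cV_n)) 0 0.

End Spectra.

(* Main.v *)
Require Import Defs.
From mathcomp Require Import all_boot all_order all_fingroup all_algebra.
From mathcomp Require Import reals complex.
From mathcomp Require Import ring zify.

(** Spectra.  Write [t = 1 - alpha], let [S] be the block of [x - A_alpha] on
    the right factor and [u] the indicator of the original vertices.  The Schur
    complement of [S] subtracts [t^2 * (1^T S^-1 1) * u u^T] from the block of
    the total graph, so the right factor enters only through its characteristic
    polynomial and its coronal, shifted by [alpha * n].  When the left factor is
    [r]-regular with incidence matrix [N], [N N^T] and [N^T N] are affine in the
    adjacency matrices of the graph and of its line graph; eliminating the edges
    leaves [f(B) - c * J] with [B = A_alpha(G)], [f] quadratic and [B J = r J].
    As [f(B) J = f(r) J], its determinant is [det f(B)] times a factor given by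
    the size and [r], and over the complex numbers [det f(B)] is a product of
    two values of the characteristic polynomial of [B].

    Non-isomorphism.  An isomorphism between two joins with nonempty right
    factor either maps the original vertices to the original vertices, or the
    edges to the edges (degrees [2r + k] and [2r] separate the two kinds); in
    each case what remains is an isomorphism of disjoint unions (or of their
    complements) with a common summand, which can be cancelled.  If the right
    factor is empty, an isomorphism of total graphs of regular graphs can map a
    vertex to an edge only in a complete component or when [r = 2]; complete
    components are matched by counting, and for [r = 2] an orientation of the
    cycles turns edges back into vertices. *)

Set Implicit Arguments.
Unset Strict Implicit.
Unset Printing Implicit Defensive.

Import Order.TTheory GRing.Theory Num.Theory.

(** * Incidence and degrees *)

Lemma adj_neq (G : sgraph) (x y : G) : adj x y -> x != y.
Proof. by apply: contraTneq => ->; rewrite adj_irrefl. Qed.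

Lemma edgeP (G : sgraph) (e : edge G) :
  exists x y, adj x y /\ val e = [set x; y].
Proof.
by case/imsetP: (valP e) => -[x y]; rewrite inE /= => xy ->; exists x, y.
Qed.

Lemma edge_set2_proof (G : sgraph) (x y : G) :
  adj x y -> [set x; y] \in edges G.
Proof. by move=> xy; apply/imsetP; exists (x, y); rewrite ?inE. Qed.

Definition mk_edge (G : sgraph) (x y : G) (xy : adj x y) : edge G :=
  exist (fun e : {set G} => e \in edges G) _ (edge_set2_proof xy).

Lemma edge_set2 (G : sgraph) (e : edge G) (x y : G) :
  x \in val e -> y \in val e -> x != y -> val e = [set x; y].
Proof.
have [a [b [_ ->]]] := edgeP e; rewrite !inE => /orP[]/eqP-> /orP[]/eqP->;
  by rewrite ?eqxx // setUC.
Qed.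

Lemma edge_adj (G : sgraph) (e : edge G) (x y : G) :
  x \in val e -> y \in val e -> x != y -> adj x y.
Proof.
have [a [b [ab ->]]] := edgeP e; rewrite !inE => /orP[]/eqP-> /orP[]/eqP->;
  by rewrite ?eqxx // adj_sym.
Qed.

Lemma edge_inj2 (G : sgraph) (e f : edge G) (x y : G) : x != y ->
  x \in val e -> y \in val e -> x \in val f -> y \in val f -> e = f.
Proof.
move=> xy xe ye xf yf; apply: val_inj.
by rewrite (edge_set2 xe ye xy) (edge_set2 xf yf xy).
Qed.

Lemma card_edge_val (G : sgraph) (e : edge G) : #|val e| = 2.
Proof. by have [x [y [/adj_neq xy ->]]] := edgeP e; rewrite cards2 xy. Qed.

Lemma edge_other (G : sgraph) (e : edge G) (x : G) : x \in val e ->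
  exists y, [/\ y \in val e, y != x & val e = [set x; y]].
Proof.
have [u [w [/adj_neq uw eE]]] := edgeP e.
rewrite eE !inE => /orP[]/eqP->; first by exists w; rewrite set22 eq_sym uw.
by exists u; rewrite set21 uw setUC.
Qed.

Lemma degreeE (G : sgraph) (x : G) : degree x = \sum_y adj x y.
Proof. by rewrite /degree cardsE -sum1_card [LHS]big_mkcond. Qed.

Lemma card_incident (G : sgraph) (x : G) :
  #|[set e : edge G | x \in val e]| = degree x.
Proof.
rewrite /degree -(card_imset _ val_inj).
rewrite -(card_in_imset (f := fun y => [set x; y])); last first.
  move=> y z; rewrite !inE => /adj_neq xy /adj_neq xz eq_yz.
  have : y \in [set x; z] by rewrite -eq_yz set22.
  by rewrite !inE eq_sym (negPf xy) => /eqP.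
congr #|pred_of_set _|; apply/setP => A; apply/imsetP/imsetP => -[].
  move=> e; rewrite inE => xe ->; have [y [ye yx ->]] := edge_other xe.
  by exists y; rewrite // inE; apply: edge_adj xe ye _; rewrite eq_sym.
move=> y; rewrite inE => xy ->; exists (mk_edge xy) => //.
by rewrite inE set21.
Qed.

Lemma sum_incident (G : sgraph) (x : G) :
  \sum_(e : edge G) (x \in val e) = degree x.
Proof.
rewrite -card_incident -sum1_card [RHS]big_mkcond; apply: eq_bigr => e _.
by rewrite inE; case: (x \in _).
Qed.

(** The entries of [N N^T = D + A] for the incidence matrix [N]: two distinct vertices lie on at
    most one common edge. *)
Lemma sum_incident2 (G : sgraph) (x y : G) :
  \sum_(e : edge G) ((x \in val e) && (y \in val e)) =
  degree x * (x == y) + adj x y.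
Proof.
have [<-|xy] := eqVneq x y.
  rewrite adj_irrefl muln1 addn0 -sum_incident.
  by apply: eq_bigr => e _; rewrite andbb.
rewrite muln0; have [adj_xy|nadj] := boolP (adj x y).
  rewrite (bigD1 (mk_edge adj_xy)) //= set21 set22 big1 // => e.
  apply: contraNeq; rewrite eqb0 negbK => /andP[xe ye].
  by apply/eqP/(edge_inj2 xy); rewrite ?set21 ?set22.
rewrite big1 // => e _; apply/eqP; rewrite eqb0.
by apply: contra nadj => /andP[xe ye]; apply: edge_adj xe ye xy.
Qed.

(** The entries of [N^T N], which is 2 plus the adjacency matrix of the line graph: distinct edges
    share at most one vertex. *)
Lemma cardI_edge (G : sgraph) (e f : edge G) :
  #|val e :&: val f| = (e == f).*2 + @total_adj G (inr e) (inr f).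
Proof.
rewrite /total_adj; have [<-|ef] := eqVneq e f.
  by rewrite setIid card_edge_val.
have [->|[x]] := set_0Vmem (val e :&: val f); first by rewrite cards0 eqxx.
rewrite inE => /andP[xe xf].
suff -> : val e :&: val f = [set x] by rewrite cards1 -card_gt0 cards1.
apply/eqP; rewrite eqEsubset sub1set inE xe xf !andbT.
apply/subsetP => y; rewrite !inE => /andP[ye yf].
by apply: contraNT ef => yx; apply/eqP/(edge_inj2 yx).
Qed.

Lemma handshake (G : sgraph) : \sum_(x : G) degree x = #|edge G|.*2.
Proof.
transitivity (\sum_(x : G) \sum_(e : edge G) (x \in val e)).
  by apply: eq_bigr => x _; rewrite sum_incident.
rewrite exchange_big /= (eq_bigr (fun=> 2)) ?sum_nat_const ?muln2 // => e _.
by rewrite -[RHS](card_edge_val e) -sum1_card [RHS]big_mkcond.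
Qed.

Lemma total_degree_vertex (G : sgraph) (x : G) :
  @degree (total_graph G) (inl x) = (degree x).*2.
Proof.
by rewrite degreeE big_sumType /= -degreeE sum_incident addnn.
Qed.

(** Counted by the ends of [e], the sum of [#|val e :&: val f|] over all [f] is [2r]; the 2
    contributed by [f = e] makes up for the two end vertices adjacent to [e]. *)
Lemma total_degree_edge (G : sgraph) r (e : edge G) :
  (forall x : G, degree x = r) -> @degree (total_graph G) (inr e) = r.*2.
Proof.
move=> degG; rewrite degreeE big_sumType /=.
have -> : \sum_(x : G) (x \in val e) = 2.
  by rewrite -[RHS](card_edge_val e) -sum1_card [RHS]big_mkcond.
transitivity (\sum_(f : edge G) #|val e :&: val f|).
  under [RHS]eq_bigr do rewrite cardI_edge.
  rewrite big_split /=; congr (_ + _).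
  by rewrite (bigD1 e) //= eqxx big1 // => f; rewrite eq_sym => /negPf->.
transitivity (\sum_(x in val e) \sum_(f : edge G) (x \in val f)).
  rewrite exchange_big; apply: eq_bigr => f _ /=.
  by rewrite -sum1_card -big_mkcondr; apply: eq_bigl => x; rewrite inE.
rewrite -mul2n -(card_edge_val e) -sum_nat_const; apply: eq_bigr => x _.
by rewrite sum_incident degG.
Qed.

Lemma tvjoin_degree_total (G H : sgraph) (s : total_graph G) :
  @degree (tvjoin G H) (inl s)
  = degree s + (if s is inl _ then #|H| else 0).
Proof.
rewrite [LHS]degreeE big_sumType (degreeE s); congr (_ + _).
by case: s => s; rewrite sum_nat_const ?muln1 ?muln0.
Qed.

Lemma tvjoin_degree_right (G H : sgraph) (h : H) :
  @degree (tvjoin G H) (inr h) = degree h + #|G|.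
Proof.
rewrite [LHS]degreeE big_sumType addnC (degreeE h); congr (_ + _).
rewrite big_sumType /= !sum_nat_const muln0 muln1 addn0; exact: eq_card.
Qed.

(** * Cancelling a summand of a disjoint union *)

Section Cancellation.
Variables (A B C : finType) (ra : rel A) (rb : rel B) (rc : rel C).
Variable phi : A + C -> B + C.

Definition sum_rel (S T : finType) (r : rel S) (s : rel T) : rel (S + T) :=
  fun x y => match x, y with
             | inl a, inl b => r a b
             | inr a, inr b => s a b
             | _, _ => false
             end.

(* [chase a] follows [a] through [phi], reentering on the left each time the
   image falls in [C]; it stops when the image falls in [B].  Since related
   points lie on the same side, their chases take the same number of steps. *)
Fixpoint chase (a : A) (i : nat) : option (A + C) :=
  if i is j.+1 then
    if chase a j is Some z then if phi z is inr c then Some (inr c) else None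
    else None
  else Some (inl a).

Lemma chaseS a i z : chase a i.+1 = Some z ->
  exists w c, [/\ chase a i = Some w, phi w = inr c & z = inr c].
Proof.
move=> /=; case: (chase a i) => // w; case def_c: (phi w) => [//|c] [<-].
by exists w, c.
Qed.

Hypothesis phi_inj : injective phi.

(** As [phi] is injective, a chase can be run backwards; only its stage 0 lies in [A], which marks
    the start. *)
Lemma chase_inj a b i j z :
  chase a i = Some z -> chase b j = Some z -> a = b /\ i = j.
Proof.
elim: i j z => [|i IHi] [|j] z.
- by move=> [<-] [].
- by move=> [<-] /chaseS[w [c [_ _]]].
- by move=> /chaseS[w [c [_ _ ->]]].
- move=> /chaseS[w [c [wi phw ->]]] /chaseS[w' [c' [wj phw' [cc']]]].
  have ww' : w = w' by apply: phi_inj; rewrite phw phw' cc'.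
  by rewrite -ww' in wj; have [-> ->] := IHi _ _ wi wj.
Qed.

Definition lands (a : A) (b : B) : Prop :=
  exists i z, chase a i = Some z /\ phi z = inl b.

(** The stages of a chase are distinct by [chase_inj], so in a finite type it must stop, which
    happens only at an image in [B]. *)
Lemma lands_ex a : exists b, lands a b.
Proof.
have [i Ni] : exists i, ~~ chase a i.
  pose n := #|{: A + C}|; pose f (i : 'I_n.+1) := odflt (inl a) (chase a i).
  have [/forallP allS|] := boolP [forall i : 'I_n.+1, chase a i : bool].
    suff /leq_card : injective f by rewrite card_ord ltnn.
    move=> i j; have := allS i; have := allS j; rewrite /f => + + zz'.
    move: zz'; case Ei: (chase a i) => [z|//]; case Ej: (chase a j) => [z'|//].
    move=> /= zz' _ _; rewrite -zz' in Ej.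
    by apply/val_inj; have [] := chase_inj Ei Ej.
  by rewrite negb_forall => /existsP[i Ni]; exists i.
elim: i Ni => [//|i IHi] /=.
case Ei: (chase a i) => [z|]; last by move=> _; apply: IHi; rewrite Ei.
by case Ez: (phi z) => [b|//] _; exists b, i, z.
Qed.

Lemma chase_prefix a i j z : i < j -> chase a j = Some z ->
  exists w c, chase a i = Some w /\ phi w = inr c.
Proof.
elim: j z => // j IHj z; rewrite ltnS leq_eqVlt => /predU1P[->|ij].
  by move=> /chaseS[w [c [wj phw _]]]; exists w, c.
by move=> /chaseS[w [c [/(IHj _ ij)]]].
Qed.

Lemma lands_fun a b b' : lands a b -> lands a b' -> b = b'.
Proof.
move=> [i [z [zi phz]]] [j [z' [zj phz']]]; case: (ltngtP i j) => [ij|ji|ij].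
- have [w [c []]] := chase_prefix ij zj.
  by rewrite zi => -[<-]; rewrite phz.
- have [w [c []]] := chase_prefix ji zi.
  by rewrite zj => -[<-]; rewrite phz'.
- by move: zj phz'; rewrite -ij zi => -[<-]; rewrite phz => -[].
Qed.

Lemma lands_inj a a' b : lands a b -> lands a' b -> a = a'.
Proof.
move=> [i [z [zi phz]]] [j [z' [zj phz']]].
have zz' : z = z' by apply: phi_inj; rewrite phz phz'.
by rewrite -zz' in zj; have [] := chase_inj zi zj.
Qed.

Hypothesis phi_mono :
  {mono phi : x y / sum_rel ra rc x y >-> sum_rel rb rc x y}.

Lemma chase_sync a a' i z : ra a a' -> chase a i = Some z ->
  exists2 z', chase a' i = Some z' & sum_rel ra rc z z'.
Proof.
move=> raa'; elim: i z => [|i IHi] z; first by move=> [<-]; exists (inl a').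
move=> /chaseS[w [c [/IHi[w' wi' rww'] phw ->]]] /=; rewrite wi'.
move: rww'; rewrite -phi_mono phw; case: (phi w') => //= c' rcc'.
by exists (inr c').
Qed.

Lemma chase_back a a' i j z z' : chase a i = Some z -> chase a' j = Some z' ->
  sum_rel ra rc z z' -> ra a a'.
Proof.
elim: i j z z' => [|i IHi] [|j] z z'.
- by move=> [<-] [<-].
- by move=> [<-] /chaseS[w [c [_ _ ->]]].
- by move=> /chaseS[w [c [_ _ ->]]] [<-].
- move=> /chaseS[w [c [wi phw ->]]] /chaseS[w' [c' [wj phw' ->]]] rcc'.
  by apply: (IHi j w w') => //; rewrite -phi_mono phw phw'.
Qed.

Lemma lands_mono a a' b b' : lands a b -> lands a' b' -> ra a a' = rb b b'.
Proof.
move=> [i [z [zi phz]]] lab'; apply/idP/idP => [raa'|rbb'].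
  have [z' zi' rzz'] := chase_sync raa' zi.
  move: rzz'; rewrite -phi_mono phz; case Ez': (phi z') => [b''|//] /= rbb''.
  by rewrite (@lands_fun a' b' b'') //; exists i, z'.
case: lab' => j [z' [zj phz']]; apply: (chase_back zi zj).
by rewrite -phi_mono phz phz'.
Qed.

End Cancellation.

(** Each point of [A] goes to where its chase lands. The relations are arbitrary, so that
    non-adjacency is covered as well. *)
Lemma cancel_sum_rel (A B C : finType) (ra : rel A) (rb : rel B) (rc : rel C)
    (phi : A + C -> B + C) : bijective phi ->
  {mono phi : x y / sum_rel ra rc x y >-> sum_rel rb rc x y} ->
  exists2 f : A -> B, bijective f & {mono f : x y / ra x y >-> rb x y}.
Proof.
move=> phi_bij phi_mono; have phi_inj := bij_inj phi_bij.
have [f fP] := fin_all_exists (lands_ex phi_inj).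
exists f => [|x y]; last by rewrite (lands_mono phi_mono (fP x) (fP y)).
apply: inj_card_bij => [x y fxy|].
  by apply: (lands_inj phi_inj (fP x)); rewrite fxy.
by have := bij_eq_card phi_bij; rewrite !card_sum => /addIn->.
Qed.

(** * Isomorphisms of joins *)

Lemma isomorphic_degree (G H : sgraph) (f : G -> H) x :
  bijective f -> {mono f : x y / adj x y} -> degree (f x) = degree x.
Proof.
move=> f_bij f_mono; rewrite !degreeE (reindex f) /=; last exact: onW_bij.
by apply: eq_bigr => y _; rewrite f_mono.
Qed.

Lemma bij_restrict (X1 X2 : Type) (S1 S2 : finType) (phi : X1 -> X2)
    (i1 : S1 -> X1) (i2 : S2 -> X2) :
  injective phi -> injective i1 -> #|S1| = #|S2| ->
  (forall s, exists t, phi (i1 s) = i2 t) ->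
  exists2 psi : S1 -> S2, bijective psi & forall s, phi (i1 s) = i2 (psi s).
Proof.
move=> phi_inj i1_inj eq_card /fin_all_exists[psi psiE]; exists psi => //.
apply: inj_card_bij => [s t eq_st|]; last by rewrite eq_card.
by apply/i1_inj/phi_inj; rewrite !psiE eq_st.
Qed.

Section JoinIsomorphism.
Variables (G1 G2 H1 H2 : sgraph) (r : nat) (phi : tvjoin G1 H1 -> tvjoin G2 H2).
Hypothesis deg1 : forall x : G1, degree x = r.
Hypothesis deg2 : forall x : G2, degree x = r.
Hypothesis eq_cardG : #|G1| = #|G2|.
Hypothesis eq_cardH : #|H1| = #|H2|.
Hypothesis H_gt0 : 0 < #|H1|.
Hypothesis phi_bij : bijective phi.
Hypothesis phi_mono : {mono phi : x y / adj x y}.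

Let phi_inj : injective phi := bij_inj phi_bij.

Lemma card_edge_regular : #|edge G1| = #|edge G2|.
Proof.
apply: double_inj; rewrite -!handshake (eq_bigr _ (fun v _ => deg1 v)).
by rewrite (eq_bigr _ (fun v _ => deg2 v)) !sum_nat_const eq_cardG.
Qed.

Lemma edge_not_to_vertex (y : G2) e : phi (inl (inr e)) <> inl (inl y).
Proof.
move=> /(congr1 (@degree _)); rewrite (isomorphic_degree _ phi_bij phi_mono).
rewrite !tvjoin_degree_total total_degree_vertex (total_degree_edge _ deg1).
by rewrite deg2; lia.
Qed.

(* An edge sent to the right factor is adjacent to the whole preimage of [G2],
   which therefore avoids [H1]; by degrees it avoids the edges as well. *)
Lemma tvjoin_iso_parts :
  (forall x, exists y, phi (inl (inl x)) = inl (inl y)) \/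
  (forall e, exists f, phi (inl (inr e)) = inl (inr f)).
Proof.
have [/existsP[e /existsP[h /eqP eh]]|noEH] :=
  boolP [exists e : edge G1, [exists h : H2, phi (inl (inr e)) == inr h]].
  left; have [psi psiK phiK] := phi_bij.
  have [||||g [g' _ gK] gE] :=
    @bij_restrict _ _ G2 G1 psi (fun y => inl (inl y)) (fun x => inl (inl x)).
  - exact: can_inj phiK.
  - by move=> y z [].
  - by rewrite eq_cardG.
  - move=> y; case def_u: (psi (inl (inl y))) => [[x|f]|h'].
    + by exists x.
    + by have := @edge_not_to_vertex y f; rewrite -def_u phiK.
    + have := phi_mono (inl (inr e)) (psi (inl (inl y))).
      by rewrite phiK eh def_u.
  - by move=> x; exists (g' x); rewrite -[x in LHS]gK -gE phiK.
right=> e; case def_u: (phi (inl (inr e))) => [[y|f]|h].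
- by have := edge_not_to_vertex def_u.
- by exists f.
- by case/existsP: noEH; exists e; apply/existsP; exists h; rewrite def_u.
Qed.

End JoinIsomorphism.

Lemma tvjoin_left_cancel (G1 G2 H : sgraph) r :
  (forall x : G1, degree x = r) -> (forall x : G2, degree x = r) ->
  #|G1| = #|G2| -> 0 < #|H| ->
  isomorphic (tvjoin G1 H) (tvjoin G2 H) -> isomorphic G1 G2.
Proof.
move=> deg1 deg2 eq_card H_gt0 [phi phi_bij phi_mono].
have phi_inj := bij_inj phi_bij.
have [phiV|phiE] :=
  tvjoin_iso_parts deg1 deg2 eq_card erefl H_gt0 phi_bij phi_mono.
  have inj_V : injective (fun x : G1 => inl (inl x) : tvjoin G1 H).
    by move=> x y [].
  have [psi psi_bij psiE] := bij_restrict phi_inj inj_V eq_card phiV.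
  exists psi => // x y.
  by have := phi_mono (inl (inl x)) (inl (inl y)); rewrite !psiE.
have inj_E : injective (fun e : edge G1 => inl (inr e) : tvjoin G1 H).
  by move=> x y [].
have [psi [psi' _ psiK] psiE] :=
  bij_restrict phi_inj inj_E (card_edge_regular deg1 deg2 eq_card) phiE.
(* Without the edges, the ordinary join of [G] and [H] remains; non-adjacency turns it into a
   disjoint union. *)
pose emb (G : sgraph) (z : G + H) : tvjoin G H :=
  match z with inl x => inl (inl x) | inr h => inr h end.
have emb_inj G : injective (@emb G) by move=> [x|h] [y|h'] //= [->].
have embE G u v : sum_rel (fun x y => ~~ adj x y) (fun x y => ~~ adj x y) u v
                  = ~~ adj (@emb G u) (emb G v).
  by case: u v => [x|h] [y|h'].
have eq_cardS : #|{: G1 + H}| = #|{: G2 + H}| by rewrite !card_sum eq_card.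
(* Every edge of [G2] is already the image of an edge, so nothing else is sent to one. *)
have chi_ex z : exists w, phi (emb G1 z) = emb G2 w.
  case def_u: (phi (emb G1 z)) => [[y|f]|h].
  - by exists (inl y).
  - have : emb G1 z = inl (inr (psi' f)).
      by apply: phi_inj; rewrite psiE psiK.
    by case: (z).
  - by exists (inr h).
have [chi chi_bij chiE] := bij_restrict phi_inj (@emb_inj G1) eq_cardS chi_ex.
have [|f f_bij f_mono] := cancel_sum_rel (ra := fun x y : G1 => ~~ adj x y)
  (rb := fun x y : G2 => ~~ adj x y) (rc := fun x y : H => ~~ adj x y) chi_bij.
  by move=> u v; rewrite !embE -!chiE phi_mono.
by exists f => // x y; apply: negb_inj; apply: f_mono.
Qed.

Lemma tvjoin_right_cancel (G H1 H2 : sgraph) r :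
  (forall x : G, degree x = r) -> #|H1| = #|H2| ->
  isomorphic (tvjoin G H1) (tvjoin G H2) -> isomorphic H1 H2.
Proof.
move=> degG eq_card [phi phi_bij phi_mono].
have phi_inj := bij_inj phi_bij.
have [H1_0|H_gt0] := posnP #|H1|.
  have noH (x : H1) : False by have := card0_eq H1_0 x; rewrite inE.
  exists (fun x => False_rect _ (noH x)); last by move=> x; case: (noH x).
  by apply: inj_card_bij => [x|]; [case: (noH x) | rewrite -eq_card H1_0].
have [phiV|phiE] :=
  tvjoin_iso_parts degG degG erefl eq_card H_gt0 phi_bij phi_mono.
  have inj_V : injective (fun x : G => inl (inl x) : tvjoin G H1).
    by move=> x y [].
  have [psi [psi' _ psiK] psiE] := bij_restrict phi_inj inj_V erefl phiV.
  (* Without the vertices of [G], the disjoint union of [H] and the line graph of [G] remains. *)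
  pose emb (H : sgraph) (z : H + edge G) : tvjoin G H :=
    match z with inl h => inr h | inr e => inl (inr e) end.
  have emb_inj H : injective (@emb H) by move=> [x|h] [y|h'] //= [->].
  have embE H u v : sum_rel (@adj H) (fun e f => @total_adj G (inr e) (inr f))
                      u v = adj (@emb H u) (emb H v).
    by case: u v => [x|h] [y|h'].
  have eq_cardS : #|{: H1 + edge G}| = #|{: H2 + edge G}|.
    by rewrite !card_sum eq_card.
  have chi_ex z : exists w, phi (emb H1 z) = emb H2 w.
    case def_u: (phi (emb H1 z)) => [[y|f]|h].
    - have : emb H1 z = inl (inl (psi' y)).
        by apply: phi_inj; rewrite psiE psiK.
      by case: (z).
    - by exists (inr f).
    - by exists (inl h).
  have [chi chi_bij chiE] := bij_restrict phi_inj (@emb_inj H1) eq_cardS chi_ex.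
  by apply: (cancel_sum_rel (ra := @adj H1) (rb := @adj H2)
    (rc := fun e f => @total_adj G (inr e) (inr f)) chi_bij) => u v;
    rewrite !embE -!chiE phi_mono.
have inj_E : injective (fun e : edge G => inl (inr e) : tvjoin G H1).
  by move=> x y [].
have [psi [psi' _ psiK] psiE] := bij_restrict phi_inj inj_E erefl phiE.
(* Without the edges, the ordinary join of [H] and [G] remains, again treated through
   non-adjacency. *)
pose emb (H : sgraph) (z : H + G) : tvjoin G H :=
  match z with inl h => inr h | inr x => inl (inl x) end.
have emb_inj H : injective (@emb H) by move=> [x|h] [y|h'] //= [->].
have embE H u v : sum_rel (fun x y => ~~ adj x y) (fun x y => ~~ adj x y) u v
                  = ~~ adj (@emb H u) (emb H v).
  by case: u v => [x|h] [y|h'].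
have eq_cardS : #|{: H1 + G}| = #|{: H2 + G}| by rewrite !card_sum eq_card.
have chi_ex z : exists w, phi (emb H1 z) = emb H2 w.
  case def_u: (phi (emb H1 z)) => [[y|f]|h].
  - by exists (inr y).
  - have : emb H1 z = inl (inr (psi' f)).
      by apply: phi_inj; rewrite psiE psiK.
    by case: (z).
  - by exists (inl h).
have [chi chi_bij chiE] := bij_restrict phi_inj (@emb_inj H1) eq_cardS chi_ex.
have [|f f_bij f_mono] := cancel_sum_rel (ra := fun x y : H1 => ~~ adj x y)
  (rb := fun x y : H2 => ~~ adj x y) (rc := fun x y : G => ~~ adj x y) chi_bij.
  by move=> u v; rewrite !embE -!chiE phi_mono.
by exists f => // x y; apply: negb_inj; apply: f_mono.
Qed.

(** * Isomorphisms of total graphs *)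

Section Orientation.
Variable G : sgraph.
Hypothesis deg2 : forall x : G, degree x = 2.

(** By [oppositeP], the default [y] is not reached when [x] and [y] are adjacent. *)
Definition opposite (x y : G) : G := odflt y [pick z | adj y z && (z != x)].

Lemma oppositeP (x y : G) : adj x y ->
  [/\ adj y (opposite x y), opposite x y != x
    & forall w, adj y w -> w = x \/ w = opposite x y].
Proof.
move=> xy; have /eqP/cards2P[a [b [ab defN]]] := deg2 y.
have NyE w : adj y w = (w == a) || (w == b).
  by have := in_set2 w a b; rewrite -defN inE.
have : adj y x by rewrite adj_sym.
rewrite NyE /opposite => xab; case: pickP => [z|none] /=.
  move=> /andP[yz zx]; split=> // w; move: yz; rewrite !NyE; move: xab zx.
  by case/orP=> /eqP-> => /[swap] /orP[]/eqP-> => + /orP[]/eqP->;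
    rewrite ?eqxx //; auto.
exfalso; case/orP: xab => /eqP xE; [have := none b|have := none a];
  by rewrite NyE xE eqxx ?orbT ?ab 1?eq_sym ?ab.
Qed.

(** One step along the cycle through a dart. Being the identity on other pairs makes it injective on
    all of them, so that connection by [turn] is symmetric. *)
Definition turn (p : G * G) : G * G :=
  if adj p.1 p.2 then (p.2, opposite p.1 p.2) else p.

Lemma turnE (x y z : G) : adj x y -> adj y z -> z != x -> turn (x, y) = (y, z).
Proof.
move=> xy yz zx; rewrite /turn /= xy; have [_ _ /(_ z yz)] := oppositeP xy.
by case=> [/eqP|->] //; rewrite (negPf zx).
Qed.

Lemma turn_inj : injective turn.
Proof.
have dart p : adj p.1 p.2 -> adj (turn p).1 (turn p).2.
  by case: p => x y /= xy; rewrite /turn /= xy; case: (oppositeP xy).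
have fixed p : ~~ adj p.1 p.2 -> turn p = p by rewrite /turn => /negPf->.
move=> p q eq_t; have [dp|ndp] := boolP (adj p.1 p.2); last first.
  have := dart q; rewrite -eq_t (fixed p) // (negPf ndp) => /contraFN.
  by move=> /(_ erefl)/fixed <-; rewrite -eq_t fixed.
have [dq|ndq] := boolP (adj q.1 q.2); last first.
  by have := dart p dp; rewrite eq_t (fixed q) // (negPf ndq).
case: p q dp dq eq_t => x y [x' y'] /= xy xy'; rewrite /turn /= xy xy'.
case=> eq_y; rewrite -eq_y in xy' * => eq_o.
have yx : adj y x by rewrite adj_sym.
have [_ ox _] := oppositeP xy; have [_ _ /(_ _ yx)[->//|xo]] := oppositeP xy'.
by rewrite eq_o -xo eqxx in ox.
Qed.

(** If [k + 2] turns reverse a dart, dropping the first and undoing the last shows that [k] turns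
    reverse the next dart; zero or one turn never does. *)
Lemma no_reversal k x y : adj x y -> iter k turn (x, y) <> (y, x).
Proof.
elim/ltn_ind: k x y => -[|[|k]] IHk x y xy.
- by case=> xE; rewrite xE adj_irrefl in xy.
- have [yo /eqP ox _] := oppositeP xy; rewrite /= /turn /= xy => -[].
  exact: ox.
have [yo ox _] := oppositeP xy; set o := opposite x y in yo ox.
rewrite iterS iterSr (turnE xy yo ox) => eq_t.
have oy : adj o y by rewrite adj_sym.
have yx : adj y x by rewrite adj_sym.
apply: (IHk k _ y o yo) => //; apply: turn_inj; rewrite eq_t.
by rewrite (turnE oy yx) // eq_sym.
Qed.

(* By [no_reversal] the orbits of opposite darts differ, so comparing their
   representatives orients every cycle consistently. *)
Definition oriented (x y : G) : bool :=
  enum_rank (froot turn (x, y)) < enum_rank (froot turn (y, x)).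

Lemma oriented_turn x y z : adj x y -> adj y z -> z != x ->
  oriented x y = oriented y z.
Proof.
have csym := fconnect_sym turn_inj.
have root_turn p q : turn p = q -> froot turn p = froot turn q.
  by move=> <-; apply/(fingraph.rootP csym); apply: fconnect1.
move=> xy yz zx; rewrite /oriented (root_turn _ _ (turnE xy yz zx)).
(* Backwards, [(z, y)] turns into [(y, x)]. *)
congr (_ < val (enum_rank _)); symmetry; apply: root_turn.
by apply: turnE; rewrite ?[adj _ x]adj_sym 1?[adj z _]adj_sym // eq_sym.
Qed.

Lemma orientedN x y : adj x y -> oriented y x = ~~ oriented x y.
Proof.
move=> xy; rewrite /oriented -leqNgt ltn_neqAle andb_idl //.
have csym := fconnect_sym turn_inj.
move=> _; apply/eqP => /val_inj/enum_rank_inj eq_root.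
have fc : fconnect turn (x, y) (y, x) by apply/(fingraph.rootP csym).
by apply: (@no_reversal (findex turn (x, y) (y, x)) x y xy); apply: iter_findex.
Qed.

(** Sending each edge to its tail turns consecutive edges of a cycle into consecutive vertices, and
    so embeds the line graph into the graph. *)
Lemma cycle_orientation : exists rho : edge G -> G,
  [/\ forall f, rho f \in val f, injective rho
    & forall f f', f != f' ->
        (val f :&: val f' != set0) = adj (rho f) (rho f')].
Proof.
have tail (f : edge G) :
    exists v w, [/\ val f = [set v; w], adj v w & oriented v w].
  have [x [y [xy fE]]] := edgeP f; have [o|no] := boolP (oriented x y).
    by exists x, y.
  by exists y, x; rewrite setUC adj_sym orientedN.
have [rho rhoP] := fin_all_exists tail; exists rho.
have rho_in f : rho f \in val f by have [w [-> _ _]] := rhoP f; rewrite set21.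
have rho_inj : injective rho.
  (* Two different darts leaving the same vertex have opposite orientations. *)
  move=> f f' eq_r; have [w [fE vw ovw]] := rhoP f.
  have := rhoP f'; rewrite -eq_r => -[w' [fE' vw' ovw']]; apply: val_inj.
  rewrite fE fE'; have [->//|ww'] := eqVneq w w'.
  have wv : adj w (rho f) by rewrite adj_sym.
  have := oriented_turn wv vw'; rewrite eq_sym => /(_ ww').
  by rewrite ovw' orientedN // ovw.
split=> // f f' ff'; have [w [fE vw ovw]] := rhoP f.
have [w' [fE' vw' ovw']] := rhoP f'.
have vv' : rho f != rho f' by rewrite (inj_eq rho_inj).
apply/set0Pn/idP => [[p]|adjv].
  (* The common vertex is the head of one edge and the tail of the other: the tails differ, and a
     common head contradicts [oriented_turn]. *)
  rewrite fE fE' !inE => /andP[/orP[]/eqP-> /orP[]]; rewrite ?(negPf vv') //.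
  - by move=> /eqP->; rewrite adj_sym.
  - by move=> /eqP<-.
  - move=> /eqP ww'; rewrite -ww' in vw' ovw'.
    have wv' : adj w (rho f') by rewrite adj_sym.
    have := oriented_turn vw wv'; rewrite eq_sym => /(_ vv').
    by rewrite ovw orientedN // ovw'.
have [v'w|v'w] := eqVneq (rho f') w.
  by exists (rho f'); rewrite inE rho_in fE v'w set22.
(* Otherwise the walk [w], [rho f], [rho f'], [w'] never turns back, yet it traverses [f] against
   its orientation and [f'] along it. *)
exists (rho f); rewrite inE rho_in /= fE' inE; apply/orP; right.
apply: contraTT ovw'; rewrite inE => vw'_neq.
have wv : adj w (rho f) by rewrite adj_sym.
have w'v' : adj w' (rho f') by rewrite adj_sym.
have v'v : adj (rho f') (rho f) by rewrite adj_sym.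
rewrite -orientedN // (oriented_turn w'v' v'v vw'_neq) orientedN //.
by rewrite -(oriented_turn wv adjv v'w) orientedN // ovw.
Qed.

End Orientation.

(** * Vertices with complete closed neighborhood *)

Definition closed_nb (G : sgraph) (x : G) : {set G} := x |: [set y | adj x y].

(** In a regular graph these are the vertices whose component is complete. *)
Definition clique_nb (G : sgraph) (x : G) : bool :=
  [forall y in closed_nb x, forall z in closed_nb x, (y != z) ==> adj y z].

Lemma clique_nbP (G : sgraph) (x : G) :
  reflect (forall y z, adj x y -> adj x z -> y != z -> adj y z) (clique_nb x).
Proof.
apply: (iffP idP) => [/forall_inP cl y z xy xz yz|cl].
  have /forall_inP/(_ z) : [forall z in closed_nb x, (y != z) ==> adj y z].
    by apply: cl; rewrite !inE xy orbT.
  by rewrite !inE xz orbT => /(_ isT)/implyP; apply.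
apply/forall_inP => y; rewrite !inE => /predU1P[->|xy].
  apply/forall_inP => z; rewrite !inE => /predU1P[->|xz]; first by rewrite eqxx.
  by rewrite xz implybT.
apply/forall_inP => z; rewrite !inE => /predU1P[->|xz].
  by rewrite adj_sym xy implybT.
by apply/implyP => yz; apply: cl.
Qed.

Lemma clique_nb_adj (G : sgraph) (x y z : G) : clique_nb x ->
  y \in closed_nb x -> z \in closed_nb x -> y != z -> adj y z.
Proof.
by move=> /forall_inP cl /cl/forall_inP clz zx yz; apply: (implyP (clz z zx)).
Qed.

Lemma card_closed_nb (G : sgraph) (x : G) : #|closed_nb x| = (degree x).+1.
Proof. by rewrite cardsU1 inE adj_irrefl. Qed.

(** A clique lies in the closed neighborhood of each of its members, and regularity makes the sizes
    equal. *)
Lemma clique_closed_nb (G : sgraph) r (x y : G) :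
  (forall z : G, degree z = r) -> clique_nb x -> y \in closed_nb x ->
  closed_nb y = closed_nb x.
Proof.
move=> degG cl yx; apply/esym/eqP; rewrite eqEcard !card_closed_nb !degG leqnn.
rewrite andbT; apply/subsetP => z zx; rewrite !inE.
by have [//|zy] := eqVneq z y; rewrite (clique_nb_adj cl yx zx) // eq_sym.
Qed.

Lemma clique_nb_trans (G : sgraph) r (x y : G) :
  (forall z : G, degree z = r) -> clique_nb x -> adj x y -> clique_nb y.
Proof.
move=> degG cl xy; have yx : y \in closed_nb x by rewrite !inE xy orbT.
by rewrite /clique_nb (clique_closed_nb degG cl yx).
Qed.

(** * Vertices sent to edges by an isomorphism of total graphs *)

Section TotalIsomorphism.
Variables (G1 G2 : sgraph) (r : nat).
Variable phi : G1 + edge G1 -> G2 + edge G2.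
Hypothesis deg1 : forall x : G1, degree x = r.
Hypothesis deg2 : forall x : G2, degree x = r.
Hypothesis phi_bij : bijective phi.
Hypothesis phi_mono :
  forall u w, @total_adj G2 (phi u) (phi w) = @total_adj G1 u w.

Let phi_inj : injective phi := bij_inj phi_bij.

(** Let [a] be the other end of [f]. The neighbors of [y] except [z] go to [a] or to edges at [b],
    and the two kinds do not occur together; with [b], the image of [z], these images are pairwise
    adjacent. *)
Lemma swapped_clique (y z : G1) (f : edge G2) (b : G2) :
  adj y z -> phi (inl y) = inr f -> phi (inl z) = inl b -> clique_nb y.
Proof.
move=> yz py pz.
have bf : b \in val f.
  by have := phi_mono (inl y) (inl z); rewrite py pz /= yz.
have [a [af ab]] := edge_other bf; rewrite setUC => fE.
have [e [ye ze eE]] : exists e : edge G1,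
    [/\ y \in val e, z \in val e & val e = [set y; z]].
  by exists (mk_edge yz); rewrite set21 set22.
(* The other edges at [y] are adjacent to [y] but not to [z], so they go to
   edges at [a]; both ends have degree [r], so all edges at [a] are reached. *)
have side (e' : edge G1) : y \in val e' -> e' != e ->
    exists g, [/\ phi (inr e') = inr g, a \in val g & g != f].
  move=> ye' ee'.
  have ze' : z \notin val e'.
    by apply: contra ee' => ze'; apply/eqP/(edge_inj2 (adj_neq yz)).
  have := phi_mono (inl z) (inr e'); have := phi_mono (inl y) (inr e').
  rewrite py pz /= ye' (negPf ze'); case pe': (phi (inr e')) => [w|g] /=.
    rewrite fE !inE => /orP[/eqP wa|/eqP wb].
      by rewrite wa adj_sym (edge_adj af bf ab).
    by have := phi_inj (etrans pe' (esym (etrans pz (congr1 inl (esym wb))))).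
  move=> /andP[fg /set0Pn[p]]; rewrite inE fE !inE => /andP[+ pg] bg.
  move=> /orP[/eqP pa|/eqP pb]; last by rewrite -pb pg in bg.
  by exists g; rewrite -pa pg eq_sym.
have cover (g : edge G2) : a \in val g -> g != f ->
    exists e', phi (inr e') = inr g.
  move=> ag gf.
  pose A := [set e' : edge G1 | y \in val e'] :\ e.
  pose B := [set g' : edge G2 | a \in val g'] :\ f.
  pose imA : {set G2 + edge G2} := [set phi (inr e') | e' in A].
  pose imB : {set G2 + edge G2} := [set inr g' | g' in B].
  have im_sub : imA \subset imB.
    apply/subsetP => _ /imsetP[e' + ->]; rewrite !inE => /andP[ee' ye'].
    have [g' [-> ag' gf']] := side e' ye' ee'.
    by apply/imsetP; exists g'; rewrite // !inE gf'.
  have card_im : #|imA| = #|imB|.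
    rewrite !card_imset; last 2 first.
    - by move=> ? ? [].
    - by move=> ? ? /phi_inj[].
    have := cardsD1 e [set e' : edge G1 | y \in val e'].
    have := cardsD1 f [set g : edge G2 | a \in val g].
    by rewrite !card_incident deg1 deg2 !inE ye af => -> [].
  have /setP/(_ (inr g)) : imA = imB.
    by apply/eqP; rewrite eqEcard im_sub card_im leqnn.
  rewrite [in RHS]imset_f ?inE ?gf // => /imsetP[e' _ pe'].
  by exists e'.
have nb w : adj y w -> w != z ->
    phi (inl w) = inl a \/ exists2 g, phi (inl w) = inr g & b \in val g.
  move=> yw wz; have := phi_mono (inl y) (inl w); rewrite py /= yw.
  case pw: (phi (inl w)) => [c|g] /=.
    rewrite fE !inE => /orP[/eqP->|/eqP cb]; first by left.
    have /phi_inj[wzE] : phi (inl w) = phi (inl z) by rewrite pw pz cb.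
    by rewrite wzE eqxx in wz.
  move=> /andP[fg /set0Pn[p]]; rewrite inE fE !inE.
  move=> /andP[/orP[/eqP->|/eqP->] pg]; last by right; exists g.
  have [|e' pe'] := cover g pg; first by rewrite eq_sym.
  by have := phi_inj (etrans pw (esym pe')).
(* The image of [yz] cannot meet two different edges at [a] outside [a]. *)
have mixed w1 w2 g : adj y w1 -> adj y w2 -> w1 != z -> w2 != z ->
    phi (inl w1) = inl a -> phi (inl w2) = inr g -> False.
  move=> yw1 yw2 w1z w2z pw1 pw2.
  have w12 : w1 != w2.
    by apply: contra_eq_neq pw1 => ->; rewrite pw2.
  have [h [pe bh hf]] :
      exists h, [/\ phi (inr e) = inr h, b \in val h & h != f].
    have := phi_mono (inl z) (inr e); have := phi_mono (inl y) (inr e).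
    rewrite py pz /= ye ze; case pe: (phi (inr e)) => [c|h] /=.
      rewrite fE !inE => /orP[]/eqP cE.
        by rewrite cE -pw1 in pe; have := phi_inj pe.
      by rewrite cE -pz in pe; have := phi_inj pe.
    by move=> /andP[fh _] bh; exists h; rewrite eq_sym.
  have ah : a \notin val h by apply: contra hf => ah; apply/eqP/(edge_inj2 ab).
  have meet w (yw : adj y w) : w != z -> exists g1 p,
      [/\ phi (inr (mk_edge yw)) = inr g1, a \in val g1, p \in val g1
        & val h = [set b; p]].
    move=> wz; have ew : mk_edge yw != e.
      apply: contraNneq wz => ewe; have : w \in val e by rewrite -ewe set22.
      by rewrite eE !inE eq_sym (negPf (adj_neq yw)).
    have [|g1 [pg1 ag1 g1f]] := side (mk_edge yw) _ ew; first exact: set21.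
    have := phi_mono (inr (mk_edge yw)) (inr e); rewrite pg1 pe /= ew /=.
    have -> : val (mk_edge yw) :&: val e != set0.
      by apply/set0Pn; exists y; rewrite inE ye set21.
    move=> /andP[_ /set0Pn[p]]; rewrite inE => /andP[pg1' ph].
    exists g1, p; split=> //; apply: (edge_set2 bh ph).
    by apply: contraNneq g1f => bp; apply/eqP/(edge_inj2 ab); rewrite // bp.
  have [g1 [p1 [pg1 ag1 p1g1 hE1]]] := meet w1 yw1 w1z.
  have [g2 [p2 [pg2 ag2 p2g2 hE2]]] := meet w2 yw2 w2z.
  have bp1 : b != p1 by have := card_edge_val h; rewrite hE1 cards2; case: eqP.
  have bp2 : b != p2 by have := card_edge_val h; rewrite hE2 cards2; case: eqP.
  have p12 : p1 = p2.
    have : p1 \in [set b; p2] by rewrite -hE2 hE1 set22.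
    by rewrite !inE eq_sym (negPf bp1) => /eqP.
  have ap1 : a != p1 by apply: contraNneq ah => ->; rewrite hE1 set22.
  have g12 : g1 = g2 by apply: (edge_inj2 ap1); rewrite // p12.
  have /phi_inj[] : phi (inr (mk_edge yw1)) = phi (inr (mk_edge yw2)).
    by rewrite pg1 pg2 g12.
  move=> e12; have : w1 \in [set y; w2] by rewrite -e12 set22.
  by rewrite !inE (negPf w12) eq_sym (negPf (adj_neq yw1)).
have adj_ab : adj a b by apply: edge_adj af bf ab.
apply/clique_nbP => w1 w2 yw1 yw2 w12.
rewrite -[adj w1 w2]/(@total_adj G1 (inl w1) (inl w2)) -phi_mono.
have [w1z|w1z] := eqVneq w1 z.
  rewrite w1z pz; have w2z : w2 != z by rewrite -w1z eq_sym.
  by have [->|[g -> bg]] := nb w2 yw2 w2z; rewrite //= adj_sym.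
have [w2z|w2z] := eqVneq w2 z.
  by rewrite w2z pz; have [->|[g -> bg]] := nb w1 yw1 w1z.
have [pw1|[g1 pw1 bg1]] := nb w1 yw1 w1z;
  have [pw2|[g2 pw2 bg2]] := nb w2 yw2 w2z.
- by have [w12E] := phi_inj (etrans pw1 (esym pw2)); rewrite w12E eqxx in w12.
- by case: (mixed w1 w2 g2).
- by case: (mixed w2 w1 g1).
- rewrite pw1 pw2 /=; apply/andP; split; last first.
    by apply/set0Pn; exists b; rewrite inE bg1.
  by apply: contraNneq w12 => g12; have [->] : inl w1 = inl w2 :> G1 + edge G1
    by apply: phi_inj; rewrite pw1 pw2 g12.
Qed.

Lemma swapped_nb_edge (y z : G1) (f : edge G2) :
  ~~ clique_nb y -> phi (inl y) = inr f -> adj y z ->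
  exists g, phi (inl z) = inr g.
Proof.
move=> ncl py yz; case pz: (phi (inl z)) => [b|g]; last by exists g.
by rewrite (swapped_clique yz py pz) in ncl.
Qed.

(* The end points of [f] come from two edges at [y]; a third edge at [y] would
   be sent to a neighbor of both end points, which only [f] is. *)
Lemma swapped_degree (y : G1) (f : edge G2) :
  ~~ clique_nb y -> phi (inl y) = inr f -> r = 2.
Proof.
move=> ncl py; have [psi psiK phiK] := phi_bij.
have pre v : v \in val f ->
    exists2 e : edge G1, y \in val e & phi (inr e) = inl v.
  move=> vf; case pv: (psi (inl v)) => [z|e].
    have pz : phi (inl z) = inl v by rewrite -pv phiK.
    have yz : adj y z by have := phi_mono (inl y) (inl z); rewrite py pz /= vf.
    by have [g] := swapped_nb_edge ncl py yz; rewrite pz.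
  have pe : phi (inr e) = inl v by rewrite -pv phiK.
  by exists e => //; have := phi_mono (inl y) (inr e); rewrite py pe /= vf.
have [a [b [/adj_neq ab fE]]] := edgeP f.
have [|e1 ye1 pe1] := pre a; first by rewrite fE set21.
have [|e2 ye2 pe2] := pre b; first by rewrite fE set22.
have e12 : e1 != e2.
  by apply: contraNneq ab => e12; move: pe1; rewrite e12 pe2 => -[->].
have -> : r = #|[set e1; e2]|; last by rewrite cards2 e12.
rewrite -(deg1 y) -card_incident; apply: eq_card => e; rewrite !inE.
apply/idP/orP => [ye|[]/eqP->] //.
have [?|ee1] := eqVneq e e1; first by left.
have [?|ee2] := eqVneq e e2; first by right.
have meet (e' : edge G1) : y \in val e' -> e != e' ->
    @total_adj G1 (inr e) (inr e').
  move=> ye' ee'; apply/andP; split=> //.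
  by apply/set0Pn; exists y; rewrite inE ye.
have := meet e1 ye1 ee1; rewrite -phi_mono pe1.
have := meet e2 ye2 ee2; rewrite -phi_mono pe2.
have := phi_mono (inl y) (inr e); rewrite py [in RHS]/= ye.
case pe: (phi (inr e)) => [c|g] /=.
  rewrite fE !inE => /orP[]/eqP cE _ _; move: pe; rewrite cE => pe.
    by have /phi_inj[eE] := etrans pe (esym pe1); rewrite eE eqxx in ee1.
  by have /phi_inj[eE] := etrans pe (esym pe2); rewrite eE eqxx in ee2.
move=> /andP[fg _] bg ag; suff fgE : f = g by rewrite fgE eqxx in fg.
by apply: (edge_inj2 ab); rewrite // fE (set21, set22).
Qed.

(** Otherwise [swapped_clique] forces all neighbors of [x] to go to neighbors of [v], and these are
    pairwise adjacent. *)
Lemma kept_clique (x : G1) (v : G2) :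
  phi (inl x) = inl v -> clique_nb v -> clique_nb x.
Proof.
move=> px cl; have [//|ncl] := boolP (clique_nb x).
have nb z : adj x z -> exists2 w, phi (inl z) = inl w & adj v w.
  move=> xz; case pz: (phi (inl z)) => [w|g].
    by exists w => //; have := phi_mono (inl x) (inl z); rewrite px pz /= xz.
  have zx : adj z x by rewrite adj_sym.
  have := swapped_clique zx pz px.
  by move=> /(clique_nb_trans deg1)/(_ zx); rewrite (negPf ncl).
suff: clique_nb x by rewrite (negPf ncl).
apply/clique_nbP => y z /nb[w py vw] /nb[w' pz vw'] yz.
have := phi_mono (inl y) (inl z); rewrite py pz /= => <-.
apply: (clique_nbP _ cl) => //; apply: contraNneq yz => ww'.
by have /phi_inj[->] : phi (inl y) = phi (inl z) by rewrite py pz ww'.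
Qed.

(** Here [r = 2], so a complete component at [v] is a triangle containing [f]. The neighbors of [x]
    then go to edges through its third vertex; these meet, which makes the neighborhood of [x] a
    clique. *)
Lemma swapped_nonclique (x : G1) (f : edge G2) (v : G2) :
  ~~ clique_nb x -> phi (inl x) = inr f -> v \in val f -> ~~ clique_nb v.
Proof.
move=> ncl px vf; have r2 := swapped_degree ncl px.
apply: contra (ncl) => cl.
have [s [sf sv fE]] := edge_other vf.
have vs : adj v s by apply: edge_adj vf sf _; rewrite eq_sym.
have cls : clique_nb s := clique_nb_trans deg2 cl vs.
have third z : adj x z ->
    exists g w, [/\ phi (inl z) = inr g, w \in val g, adj v w & w != s].
  move=> xz; have [g pz] := swapped_nb_edge ncl px xz.
  have := phi_mono (inl x) (inl z); rewrite px pz /= xz => /andP[fg].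
  move=> /set0Pn[p]; rewrite inE => /andP[pf pg].
  have [w [wg wp gE]] := edge_other pg.
  have pw : adj p w by apply: edge_adj pg wg _; rewrite eq_sym.
  have wf : w \notin val f by apply: contra fg => wf; apply/eqP/(edge_inj2 wp).
  have ws : w != s by apply: contraNneq wf => ->.
  have vw : v != w by apply: contraNneq wf => <-.
  exists g, w; split=> //; move: pf; rewrite fE !inE => /orP[]/eqP pE.
    by rewrite -pE.
  by apply: (clique_nbP _ cls); rewrite // ?[adj s v]adj_sym // -pE.
apply/clique_nbP => y z /third[g [w [py wg vw ws]]].
move=> /third[g' [w' [pz wg' vw' ws']]] yz.
have ww' : w = w'.
  have /eqP/cards2P[p [q [pq NE]]] : degree v = 2 by rewrite deg2.
  have Nv u : adj v u -> u = p \/ u = q.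
    move=> vu; have := in_set2 u p q.
    by rewrite -NE inE vu => /esym/orP[]/eqP; auto.
  by move: ws ws'; case: (Nv s vs) (Nv w vw) (Nv w' vw') => -> [] -> [] ->;
    rewrite ?eqxx.
have := phi_mono (inl y) (inl z); rewrite py pz /= => <-.
apply/andP; split; last by apply/set0Pn; exists w; rewrite inE wg ww'.
apply: contraNneq yz => gg'.
by have /phi_inj[->] : phi (inl y) = phi (inl z) by rewrite py pz gg'.
Qed.

(** For [r = 2] the tails of [cycle_orientation], otherwise any ends: by [swapped_degree],
    non-clique vertices are sent to edges only if [r = 2]. *)
Lemma edge_representative : exists rho : edge G2 -> G2,
  (forall f, rho f \in val f) /\
  (r = 2 -> injective rho /\ forall f f', f != f' ->
     (val f :&: val f' != set0) = adj (rho f) (rho f')).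
Proof.
have [r2|r2] := eqVneq r 2.
  have deg x : @degree G2 x = 2 by rewrite deg2.
  by have [rho [rho_in rho_inj rho_adj]] := cycle_orientation deg; exists rho.
have rep (f : edge G2) : exists v, v \in val f.
  by have [u [w [_ ->]]] := edgeP f; exists u; rewrite set21.
by have [rho rho_in] := fin_all_exists rep; exists rho; split=> // /eqP;
  rewrite (negPf r2).
Qed.

(** A vertex sent to an edge is passed on to the representative end of that edge. *)
Lemma total_iso_nonclique : exists F : G1 -> G2,
  forall x y, ~~ clique_nb x -> ~~ clique_nb y ->
  [/\ ~~ clique_nb (F x), F x = F y -> x = y & adj (F x) (F y) = adj x y].
Proof.
have [rho [rho_in rho2]] := edge_representative.
exists (fun x => match phi (inl x) with inl v => v | inr f => rho f end).
have mixed x y v f : ~~ clique_nb x -> ~~ clique_nb y ->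
    phi (inl x) = inl v -> phi (inl y) = inr f ->
    [/\ adj x y = false, v != rho f & adj v (rho f) = false].
  move=> nx ny px py.
  have nxy : adj x y = false.
    apply: contraNF (ny) => xy; rewrite adj_sym in xy.
    exact: (swapped_clique xy py px).
  have vf : v \notin val f.
    by have := phi_mono (inl x) (inl y); rewrite px py /= nxy => ->.
  split=> //; first by apply: contraNneq vf => ->.
  (* If [v] and [rho f] are adjacent, the edge [g] between them comes from a neighbor of [x], which
     [swapped_clique] excludes, or from an edge joining [x] and [y]. *)
  apply/negP => vw; pose g := mk_edge vw; have [psi psiK phiK] := phi_bij.
  have xne : x != y by apply: contra_eq_neq px => ->; rewrite py.
  have fg : f != g by apply: contraNneq vf => ->; rewrite set21.
  have fIg : val f :&: val g != set0.
    by apply/set0Pn; exists (rho f); rewrite inE rho_in set22.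
  case pg: (psi (inr g)) => [z|e].
    have pz : phi (inl z) = inr g by rewrite -pg phiK.
    have := phi_mono (inl x) (inl z); rewrite px pz /= set21 => /esym xz.
    have zx : adj z x by rewrite adj_sym.
    have := swapped_clique zx pz px.
    by move=> /(clique_nb_trans deg1)/(_ zx); rewrite (negPf nx).
  have pe : phi (inr e) = inr g by rewrite -pg phiK.
  have := phi_mono (inl x) (inr e); rewrite px pe /= set21 => /esym xe.
  have := phi_mono (inl y) (inr e); rewrite py pe /= fg fIg => /esym ye.
  by rewrite (edge_adj xe ye xne) in nxy.
move=> x y nx ny.
case px: (phi (inl x)) => [v|f]; case py: (phi (inl y)) => [w|g].
- split.
  + by apply: contra nx; apply: kept_clique px.
  + by move=> vw; rewrite vw -py in px; have [] := phi_inj px.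
  + by have := phi_mono (inl x) (inl y); rewrite px py.
- have [xy vne vw] := mixed x y v g nx ny px py; split.
  + by apply: contra nx; apply: kept_clique px.
  + by move=> vE; rewrite vE eqxx in vne.
  + by rewrite xy vw.
- have [yx vne vw] := mixed y x w f ny nx py px; split.
  + exact: (swapped_nonclique nx px (rho_in f)).
  + by move=> vE; rewrite vE eqxx in vne.
  + by rewrite adj_sym vw adj_sym.
- have r2 := swapped_degree nx px.
  have [rho_inj rho_adj] := rho2 r2; split.
  + exact: (swapped_nonclique nx px (rho_in f)).
  + by move=> /rho_inj fg; rewrite fg -py in px; have [] := phi_inj px.
  + have := phi_mono (inl x) (inl y); rewrite px py /= => <-.
    have [->|fg] := eqVneq f g; first by rewrite adj_irrefl.
    by rewrite rho_adj.
Qed.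

End TotalIsomorphism.

(** Both sets are unions of complete components of order [r + 1], which are matched one pair at a
    time. The map [g0] serves as the result when [A] is empty. *)
Lemma clique_blocks (G1 G2 : sgraph) r (g0 : G1 -> G2)
    (A : {set G1}) (B : {set G2}) :
  (forall x : G1, degree x = r) -> (forall x : G2, degree x = r) ->
  (forall x, x \in A -> clique_nb x /\ closed_nb x \subset A) ->
  (forall x, x \in B -> clique_nb x /\ closed_nb x \subset B) ->
  #|A| = #|B| ->
  exists g : G1 -> G2, forall x y, x \in A -> y \in A ->
    [/\ g x \in B, g x = g y -> x = y & adj (g x) (g y) = adj x y].
Proof.
move=> deg1 deg2; have [n] := ubnP #|A|.
elim: n A B => // n IHn A B cardA clA clB eq_card.
have [A0|[x xA]] := set_0Vmem A; first by exists g0 => x y; rewrite A0 inE.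
have [B0|[y yB]] := set_0Vmem B.
  by move: xA; rewrite (card0_eq (_ : #|A| = 0)) // eq_card B0 cards0.
have [clx NxA] := clA x xA; have [cly NyB] := clB y yB.
pose N := closed_nb x; pose M := closed_nb y.
have cardNM : #|N| = #|M| by rewrite !card_closed_nb deg1 deg2.
have xN : x \in N by rewrite !inE eqxx.
have rest (G : sgraph) (z : G) (C : {set G}) : (forall u : G, degree u = r) ->
    (forall u, u \in C -> clique_nb u /\ closed_nb u \subset C) -> z \in C ->
    forall u, u \in C :\: closed_nb z ->
    clique_nb u /\ closed_nb u \subset C :\: closed_nb z.
  move=> degG clC zC u; rewrite inE => /andP[uz uC].
  have [clu uNC] := clC u uC; split=> //; rewrite subsetD uNC /=.
  rewrite disjoint_subset; apply/subsetP => w wu; rewrite inE.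
  apply: contra uz => wz; have [clz _] := clC z zC.
  rewrite -(clique_closed_nb degG clz wz) (clique_closed_nb degG clu wu).
  by rewrite !inE eqxx.
have cardD : #|A :\: N| = #|B :\: M|.
  by rewrite !cardsD (setIidPr NxA) (setIidPr NyB) eq_card cardNM.
have ltA : #|A :\: N| < n.
  rewrite -ltnS; apply: leq_trans cardA; rewrite ltnS; apply: proper_card.
  by apply/properP; split; [apply: subsetDl | exists x; rewrite // inE xN].
have [g gP] := IHn (A :\: N) (B :\: M) ltA
                   (rest _ _ _ deg1 clA xA) (rest _ _ _ deg2 clB yB) cardD.
(* Any bijection of cliques preserves adjacency, so the two enumerations are matched; the default
   [y] is not reached on [N]. *)
pose h z := nth y (enum M) (index z (enum N)).
have idx z : z \in N -> index z (enum N) < size (enum M).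
  by move=> zN; rewrite -cardE -cardNM cardE index_mem mem_enum.
have hM z : z \in N -> h z \in M.
  by move=> zN; rewrite -mem_enum mem_nth // idx.
have h_inj z w : z \in N -> w \in N -> h z = h w -> z = w.
  move=> zN wN /eqP; rewrite nth_uniq ?enum_uniq ?idx // => /eqP eq_i.
  rewrite -[z](nth_index x (s := enum N)) ?mem_enum // eq_i.
  by rewrite nth_index ?mem_enum.
have cross (G : sgraph) (z u w : G) : (forall u : G, degree u = r) ->
    clique_nb z -> u \in closed_nb z -> w \notin closed_nb z ->
    adj u w = false.
  move=> degG clz uz; apply: contraNF => uw.
  by rewrite -(clique_closed_nb degG clz uz) !inE uw orbT.
exists (fun z => if z \in N then h z else g z) => z w zA wA.
have gP' u v : u \in A -> v \in A -> u \notin N -> v \notin N ->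
    [/\ g u \in B, g u \notin M, g u = g v -> u = v
      & adj (g u) (g v) = adj u v].
  move=> uA vA uN vN; have [||gB g_inj g_adj] := gP u v.
  - by rewrite in_setD uN.
  - by rewrite in_setD vN.
  - by move: gB; rewrite in_setD => /andP[gM gB].
case: ifPn => zN; case: ifPn => wN.
- split; first by apply: (subsetP NyB); apply: hM.
    exact: h_inj.
  have [->|zw] := eqVneq z w; first by rewrite !adj_irrefl.
  rewrite (clique_nb_adj clx zN wN zw).
  rewrite (clique_nb_adj cly (hM z zN) (hM w wN)) //.
  by apply: contraNneq zw => /(h_inj z w zN wN)->.
- have [gB gM _ _] := gP' w w wA wA wN wN; split.
  + by apply: (subsetP NyB); apply: hM.
  + by move=> hg; rewrite -hg hM in gM.
  + rewrite (cross _ _ _ _ deg1 clx zN wN).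
    by rewrite (cross _ _ _ _ deg2 cly (hM z zN) gM).
- have [gB gM _ _] := gP' z z zA zA zN zN; split=> //.
  + by move=> gh; rewrite gh hM in gM.
  + rewrite adj_sym [RHS]adj_sym (cross _ _ _ _ deg1 clx wN zN).
    by rewrite (cross _ _ _ _ deg2 cly (hM w wN) gM).
- by have [gB _ g_inj g_adj] := gP' z w zA wA zN wN.
Qed.

(** [total_iso_nonclique], used in both directions, shows that the numbers of non-clique vertices
    agree. Hence [clique_blocks] applies to the others, and no edge joins the two kinds. *)
Lemma total_graph_cancel (G1 G2 : sgraph) r :
  (forall x : G1, degree x = r) -> (forall x : G2, degree x = r) ->
  #|G1| = #|G2| -> isomorphic (total_graph G1) (total_graph G2) ->
  isomorphic G1 G2.
Proof.
move=> deg1 deg2 eq_card [phi phi_bij phi_mono].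
have [F FP] := total_iso_nonclique deg1 deg2 phi_bij phi_mono.
have card_le (G G' : sgraph) (f : G -> G') :
    (forall x y, ~~ clique_nb x -> ~~ clique_nb y ->
      [/\ ~~ clique_nb (f x), f x = f y -> x = y
        & adj (f x) (f y) = adj x y]) ->
    #|~: [set x : G | clique_nb x]| <= #|~: [set x : G' | clique_nb x]|.
  move=> fP; rewrite -(card_in_imset (f := f)) => [|x y]; last first.
    by rewrite !inE => nx ny; have [] := fP x y nx ny.
  apply: subset_leq_card; apply/subsetP => _ /imsetP[x + ->].
  by rewrite !inE => nx; have [] := fP x x nx nx.
have eq_cardK : #|[set x : G1 | clique_nb x]| = #|[set x : G2 | clique_nb x]|.
  have [psi psiK phiK] := phi_bij.
  have psi_bij : bijective psi by exists phi.
  have psi_mono u w : @total_adj G1 (psi u) (psi w) = @total_adj G2 u w.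
    by have := phi_mono (psi u) (psi w); rewrite !phiK => /esym.
  have [F' FP'] := total_iso_nonclique deg2 deg1 psi_bij psi_mono.
  have := cardsC [set x : G1 | clique_nb x]; rewrite eq_card.
  rewrite -(cardsC [set x : G2 | clique_nb x]).
  have -> : #|~: [set x : G1 | clique_nb x]| = #|~: [set x : G2 | clique_nb x]|.
    by apply/eqP; rewrite eqn_leq (card_le _ _ _ FP) (card_le _ _ _ FP').
  by move/addIn.
have block (G : sgraph) : (forall x : G, degree x = r) ->
    forall x, x \in [set x : G | clique_nb x] ->
    clique_nb x /\ closed_nb x \subset [set x : G | clique_nb x].
  move=> degG x; rewrite inE => cl; split=> //; apply/subsetP => y.
  rewrite !inE => /predU1P[->//|]; exact: clique_nb_trans degG cl.
have [g gP] := clique_blocks F deg1 deg2 (block _ deg1) (block _ deg2) eq_cardK.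
pose f x := if clique_nb x then g x else F x.
have cross (G : sgraph) (x y : G) : (forall x : G, degree x = r) ->
    clique_nb x -> ~~ clique_nb y -> adj x y = false.
  by move=> degG cl; apply: contraNF; apply: clique_nb_trans degG cl.
have gK x : clique_nb x -> clique_nb (g x).
  by move=> cl; have [] := gP x x; rewrite !inE.
have FK x : ~~ clique_nb x -> ~~ clique_nb (F x).
  by move=> ncl; have [] := FP x x ncl ncl.
have fP x y : (f x = f y -> x = y) /\ adj (f x) (f y) = adj x y.
  rewrite /f; case: ifPn => cx; case: ifPn => cy.
  - by have [||_] := gP x y; rewrite ?inE.
  - split; first by move=> gF; have := FK y cy; rewrite -gF gK.
    by rewrite (cross _ _ _ deg1 cx cy) (cross _ _ _ deg2 (gK x cx) (FK y cy)).
  - split; first by move=> Fg; have := FK x cx; rewrite Fg gK.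
    rewrite adj_sym [RHS]adj_sym (cross _ _ _ deg1 cy cx).
    by rewrite (cross _ _ _ deg2 (gK y cy) (FK x cx)).
  - by have [_] := FP x y cx cy.
exists f => [|x y]; last by have [] := fP x y.
by apply: inj_card_bij => [x y|]; [have [] := fP x y | rewrite eq_card].
Qed.

Lemma tvjoin_empty_cancel (G1 G2 H : sgraph) : #|H| = 0 ->
  isomorphic (tvjoin G1 H) (tvjoin G2 H) ->
  isomorphic (total_graph G1) (total_graph G2).
Proof.
move=> H0 [phi phi_bij phi_mono].
have inl_inj : injective (inl : total_graph G1 -> tvjoin G1 H).
  by move=> u w [].
have eq_card : #|total_graph G1| = #|total_graph G2|.
  by have := bij_eq_card phi_bij; rewrite !(card_sum _ H) => /addIn.
have phi_inl s : exists t : total_graph G2, phi (inl s) = inl t.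
  case: (phi (inl s)) => [t|h]; first by exists t.
  by have := card0_eq H0 h; rewrite inE.
have [psi psi_bij psiE] :=
  bij_restrict (bij_inj phi_bij) inl_inj eq_card phi_inl.
by exists psi => // u w; have := phi_mono (inl u) (inl w); rewrite !psiE.
Qed.

Local Open Scope ring_scope.

(** * Characteristic polynomials *)

Lemma mup_prod_XsubC (F : fieldType) (s : seq F) (x : F) :
  mup x (\prod_(a <- s) ('X - a%:P)) = count_mem x s.
Proof.
elim: s => [|a s IHs].
  by rewrite big_nil mupNroot // rootE hornerC oner_eq0.
have nz : \prod_(b <- s) ('X - b%:P) != 0.
  by apply/monic_neq0/monic_prod_XsubC.
rewrite big_cons mupM ?polyXsubC_eq0 // IHs.
by have := mup_XsubCX 1 x a; rewrite expr1 => ->; rewrite /=; case: eqP.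
Qed.

Lemma horner_char_poly (F : comNzRingType) n (M : 'M[F]_n) x :
  (char_poly M).[x] = \det (x%:M - M).
Proof.
rewrite -[LHS]/(horner_eval x _) /char_poly -det_map_mx; congr (\det _).
apply/matrixP => i j; rewrite !mxE /= /horner_eval !hornerE.
by rewrite hornerMn hornerX.
Qed.

(** [(p - q) * d] vanishes everywhere, and the natural numbers provide enough distinct roots. This
    allows determinants to be compared only where the blocks to be inverted are invertible. *)
Lemma eq_poly_off_roots (F : numFieldType) (p q d : {poly F}) :
  d != 0 -> (forall x, ~~ root d x -> p.[x] = q.[x]) -> p = q.
Proof.
move=> nz_d eq_pq; apply/eqP; rewrite -subr_eq0; apply/eqP.
suff /eqP: (p - q) * d = 0 by rewrite mulf_eq0 (negPf nz_d) orbF => /eqP.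
set f := _ * d; pose s : seq F := [seq i%:R | i <- iota 0 (size f).+1].
apply: (@roots_geq_poly_eq0 _ f s).
- apply/allP => x _; rewrite /f rootM rootE hornerD hornerN subr_eq0.
  by case: (boolP (root d x)) => [rd|/eq_pq ->]; rewrite ?rd ?eqxx ?orbT.
- rewrite map_inj_uniq ?iota_uniq // => i j /eqP.
  by rewrite eqr_nat => /eqP.
- by rewrite size_map size_iota.
Qed.

Lemma char_poly_conj (F : comUnitRingType) n (P D : 'M[F]_n) :
  P \in unitmx -> char_poly (invmx P *m D *m P) = char_poly D.
Proof.
move=> uP; rewrite /char_poly /char_poly_mx !map_mxM.
set p := map_mx _ P; set p' := map_mx _ (invmx P).
have pp : p' *m p = 1%:M by rewrite -map_mxM mulVmx // map_mx1.
have -> : 'X%:M - p' *m map_mx (@polyC F) D *m p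
          = p' *m ('X%:M - map_mx (@polyC F) D) *m p.
  by rewrite mulmxBr mulmxBl scalar_mxC -(mulmxA _ p' p) pp mulmx1.
by rewrite !det_mulmx mulrAC -det_mulmx pp det1 mul1r.
Qed.

Lemma eq_char_poly_size (F : nzRingType) m n (M : 'M[F]_m) (N : 'M[F]_n) :
  char_poly M = char_poly N -> m = n.
Proof.
move=> /(congr1 (fun p : {poly F} => size p)).
by rewrite !size_char_poly => -[].
Qed.

(** Over [R[i]] the matrix is Hermitian, hence diagonalizable with real eigenvalues, and the
    factorization descends to [R]. *)
Lemma symmetric_char_poly (R : rcfType) n (M : 'M[R]_n) :
  M^T = M -> exists s : seq R, char_poly M = \prod_(a <- s) ('X - a%:P).
Proof.
move=> symM; pose toC : {rmorphism R -> R[i]} := real_complex R.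
pose A := map_mx toC M.
have hA : A \is hermsymmx.
  apply: realsym_hermsym.
    apply/is_hermitianmxP; rewrite expr0 scale1r map_mx_id // /A.
    by rewrite map_trmx symM.
  by apply/mxOverP => i j; rewrite !mxE; apply/complex_realP; exists (M i j).
have /orthomx_spectralP A_eq := hermitian_normalmx hA.
have /mxOverP dreal := hermitian_spectral_diag_real hA.
set d := spectral_diag A in A_eq dreal.
exists [seq complex.Re (d 0 i) | i <- enum 'I_n].
apply: (@map_poly_inj _ _ toC); rewrite map_char_poly -/A A_eq.
rewrite char_poly_conj ?spectral_unit // char_poly_trig ?diag_mx_is_trig //.
rewrite rmorph_prod /= big_map big_enum; apply: eq_bigr => i _.
by rewrite mxE eqxx rmorphB /= map_polyX map_polyC /= RRe_real.
Qed.

(** Both polynomials split over [R], so the multiplicities of their real roots determine them. *)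
Lemma eq_spectrum_char_poly (R : realType) m n (M : 'M[R]_m) (N : 'M[R]_n) :
  M^T = M -> N^T = N -> spectrum M =1 spectrum N -> char_poly M = char_poly N.
Proof.
move=> /symmetric_char_poly[s Ms] /symmetric_char_poly[t Nt] eqMN.
rewrite Ms Nt; apply: perm_big.
apply/allP => x _ /=; rewrite -!mup_prod_XsubC -Ms -Nt.
by apply/eqP/eqMN.
Qed.

(** Rows and columns are permuted alike, so the signs cancel. The vertices of a join can thus be
    numbered by blocks. *)
Lemma det_reindex (F : comNzRingType) (T : finType) n (e : 'I_n -> T)
    (f : T -> T -> F) : bijective e ->
  \det (\matrix_(i, j) f (e i) (e j))
  = \det (\matrix_(i < #|T|, j < #|T|) f (enum_val i) (enum_val j)).
Proof.
move=> bij_e; have := bij_eq_card bij_e; rewrite card_ord => def_n.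
case: _ / (esym def_n) e bij_e => e bij_e.
have inj_s : injective (fun i => enum_rank (e i)).
  by move=> i j /enum_rank_inj/(bij_inj bij_e).
set M := (X in _ = \det X); pose s := perm inj_s.
have -> : (\matrix_(i, j) f (e i) (e j)) = row_perm s (col_perm s M).
  by apply/matrixP => i j; rewrite !mxE !permE !enum_rankK.
rewrite row_permE col_permE !det_mulmx !det_perm odd_permV.
by rewrite mulrC -mulrA -expr2 sqrr_sign mulr1.
Qed.

Lemma det_schur (F : fieldType) m n (A : 'M[F]_m) B C (D : 'M[F]_n) :
  D \in unitmx ->
  \det (block_mx A B C D) = \det D * \det (A - B *m invmx D *m C).
Proof.
move=> uD.
have -> : block_mx A B C D = block_mx 1%:M (B *m invmx D) 0 1%:M
     *m block_mx (A - B *m invmx D *m C) 0 C D.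
  by rewrite mulmx_block !mul1mx !mul0mx !add0r subrK mulmxKV.
by rewrite det_mulmx det_ublock det_lblock !det1 !mul1r mulrC.
Qed.

Lemma eq_char_poly_det_quadratic (R : rcfType) m n (M : 'M[R]_m) (N : 'M[R]_n)
    (b c : R) : char_poly M = char_poly N ->
  \det (M *m M + b *: M + c%:M) = \det (N *m N + b *: N + c%:M).
Proof.
move=> eqMN; pose toC : {rmorphism R -> R[i]} := real_complex R.
pose disc := sqrtc (toC (b ^+ 2 - 4 * c)).
(* With the roots [u] and [v] of the quadratic, the matrix becomes [(u - A) (v - A)]. *)
pose u := (- toC b + disc) / 2; pose v := (- toC b - disc) / 2.
have uDv : u + v = - toC b by rewrite /u /v; field.
have uMv : u * v = toC c.
  have : disc ^+ 2 = toC b ^+ 2 - 4 * toC c.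
    by rewrite sqr_sqrtc rmorphB rmorphXn rmorphM rmorph_nat.
  by rewrite /u /v => discE; field: discE.
have factor k (A : 'M[R]_k) : toC (\det (A *m A + b *: A + c%:M))
    = (map_poly toC (char_poly A)).[u] * (map_poly toC (char_poly A)).[v].
  rewrite map_char_poly !horner_char_poly -det_map_mx -det_mulmx.
  congr (\det _); rewrite !map_mxD map_mxM map_mxZ map_scalar_mx -uMv.
  rewrite mulmxBl !mulmxBr -!scalar_mxM mul_scalar_mx mul_mx_scalar.
  rewrite -[toC b]opprK -uDv scaleNr scalerDl.
  by rewrite opprB opprD addrCA; apply/matrixP => i j; rewrite !mxE; ring.
by apply: complexI; rewrite -!/(toC _) !factor eqMN.
Qed.

(** To be used with [B = A_alpha(G)], [N] the incidence matrix, [t = 1 - alpha],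
    [s = (1 - 2 alpha) r] and [g] the weight contributed by the right factor. The scalar [f] is the
    quadratic in [B] evaluated at [r], and [q ^+ n] clears the inverse of [q] in the Schur
    complement. *)
Lemma det_incidence_block (F : fieldType) n m (B : 'M[F]_n) (N : 'M[F]_(n, m))
    (p q r s t g : F)
    (f := r ^+ 2 - (q - s + p + t) * r + ((q - s) * p - t * s)) :
  t *: (N *m N^T) = B + s%:M ->
  B *m (const_mx 1 : 'M_n) = r *: const_mx 1 ->
  q != 0 -> f != 0 ->
  \det (block_mx (p%:M - B - g *: const_mx 1) (- t *: N)
                 (- t *: N^T) (q%:M - t *: (N^T *m N))) * q ^+ n
  = q ^+ m
    * \det (B *m B - (q - s + p + t) *: B + ((q - s) * p - t * s)%:M)
    * \det (1%:M - (g * (q - s - r) / f) *: (const_mx 1 : 'M_n)).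
Proof.
set J := const_mx 1 => NN BJ nz_q nz_f.
set P := p%:M - B - g *: J.
(* Adding [N^T] times the first block row makes the last block scalar. *)
have -> : block_mx P (- t *: N) (- t *: N^T) (q%:M - t *: (N^T *m N))
   = block_mx 1%:M 0 N^T 1%:M
     *m block_mx P (- t *: N) (- (N^T *m (t%:M + P))) q%:M.
  rewrite mulmx_block !mul1mx !mul0mx !addr0 (mulmxDr N^T t%:M) mul_mx_scalar.
  congr block_mx; first by rewrite addrC opprD subrK scaleNr.
  by rewrite scaleNr mulmxN -scalemxAr addrC.
rewrite det_mulmx det_lblock !det1 !mul1r det_schur; last first.
  by rewrite unitmxE det_scalar unitrX // unitfE.
rewrite det_scalar -!mulrA; congr (_ * _).
rewrite mulrC -det_scalar -!det_mulmx; congr (\det _).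
have -> : q%:M *m (P - - t *: N *m invmx q%:M *m - (N^T *m (t%:M + P)))
    = q *: P - (B + s%:M) *m (t%:M + P).
  rewrite -NN invmx_scalar scaleNr !mulNmx mulmxN opprK mul_mx_scalar.
  rewrite -!scalemxAl mulmxA mul_scalar_mx scalerBr !scalerA ?mulrA mulfV //.
  by rewrite mul1r.
set b := q - s + p + t in f nz_f *; set c := _ - t * s in f nz_f *.
(* The quadratic acts on [J] as [f], so after division by [f] it can be split off as a left factor
   from the term in [J]. *)
have fJ : (B *m B - b *: B + c%:M) *m J = f *: J.
  rewrite !mulmxDl mulNmx -scalemxAl mul_scalar_mx -mulmxA BJ -scalemxAr BJ.
  by rewrite !scalerA -scaleNr -!scalerDl /f expr2.
rewrite mulmxBr mulmx1 -scalemxAr fJ scalerA -!mulrA mulVf // mulr1.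
rewrite {}/P mulmxDl !mulmxDr !mulmxN -scalemxAr BJ.
rewrite !(mul_scalar_mx, mul_mx_scalar).
by apply/matrixP => i j; rewrite /b /c !mxE; ring.
Qed.

(** * Characteristic polynomials of joins *)

Lemma trmx_Aalpha (R : realType) (a : R) (G : sgraph) :
  (Aalpha_mx a G)^T = Aalpha_mx a G.
Proof.
rewrite linearD !linearZ /= tr_diag_mx; congr (_ + _ *: _).
by apply/matrixP => i j; rewrite !mxE adj_sym.
Qed.

Lemma horner_char_poly_Aalpha (R : realType) (a : R) (G : sgraph) n
    (e : 'I_n -> G) x : bijective e ->
  (char_poly (Aalpha_mx a G)).[x]
  = \det (\matrix_(i, j) ((x - a * (degree (e i))%:R) *+ (e i == e j)
                          - (1 - a) * (adj (e i) (e j))%:R)).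
Proof.
move=> bij_e; rewrite horner_char_poly.
rewrite (det_reindex (fun u v => (x - a * (degree u)%:R) *+ (u == v)
                          - (1 - a) * (adj u v)%:R) bij_e).
congr (\det _); apply/matrixP => i j; rewrite !mxE (inj_eq enum_val_inj).
by case: eqVneq => [->|_]; rewrite ?mulr1n ?mulr0n; ring.
Qed.

Lemma det_join_block (F : fieldType) n k (W : 'M[F]_n) (S : 'M[F]_k)
    (u : 'cV[F]_n) (c : F) : S \in unitmx ->
  \det (block_mx W (- c *: (u *m (const_mx 1 : 'rV_k)))
                   (- c *: ((const_mx 1 : 'cV_k) *m u^T)) S)
  = \det S * \det (W - (c ^+ 2 * ((const_mx 1 : 'rV_k) *m invmx S
                                    *m (const_mx 1 : 'cV_k)) 0 0)
                       *: (u *m u^T)).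
Proof.
move=> uS; rewrite det_schur //; congr (_ * \det (_ - _)).
set o : 'rV_k := const_mx 1; set o' : 'cV_k := const_mx 1.
set g := o *m invmx S *m o'.
have -> : - c *: (u *m o) *m invmx S *m (- c *: (o' *m u^T))
        = (c ^+ 2) *: (u *m g *m u^T).
  rewrite -!(scalemxAl, scalemxAr) scalerA mulrNN expr2 /g.
  by rewrite !mulmxA.
by rewrite [g]mx11_scalar mul_mx_scalar -scalemxAl scalerA !mxE eqxx mulr1n.
Qed.

Definition tv_index (G H : sgraph)
  (i : 'I_(#|G| + #|edge G| + #|H|)) : tvjoin G H :=
  match split i with
  | inl j => match split j with
             | inl k => inl (inl (enum_val k))
             | inr k => inl (inr (enum_val k))
             end
  | inr k => inr (enum_val k)
  end.

Lemma tv_index_bij (G H : sgraph) : bijective (@tv_index G H).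
Proof.
exists (fun z => match z with
  | inl (inl x) => lshift _ (lshift _ (enum_rank x))
  | inl (inr e) => lshift _ (rshift _ (enum_rank e))
  | inr h => rshift _ (enum_rank h) end).
- move=> i; rewrite /tv_index.
  case: (splitP i) => [j|j] def_i; last first.
    by rewrite enum_valK; apply/val_inj.
  case: (splitP j) => k def_j; rewrite enum_valK; apply/val_inj => /=;
  by rewrite def_i def_j.
- by case=> [[x|e]|h]; rewrite /tv_index ?(unsplitK (inl _))
    ?(unsplitK (inr _)) enum_rankK.
Qed.

Lemma tv_index_vertex (G H : sgraph) i :
  @tv_index G H (lshift _ (lshift _ i)) = inl (inl (enum_val i)).
Proof. by rewrite /tv_index (unsplitK (inl _)) (unsplitK (inl _)). Qed.

Lemma tv_index_edge (G H : sgraph) i :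
  @tv_index G H (lshift _ (rshift _ i)) = inl (inr (enum_val i)).
Proof. by rewrite /tv_index (unsplitK (inl _)) (unsplitK (inr _)). Qed.

Lemma tv_index_right (G H : sgraph) i :
  @tv_index G H (rshift _ i) = inr (enum_val i).
Proof. by rewrite /tv_index (unsplitK (inr _)). Qed.

Definition tv_indexE := (tv_index_vertex, tv_index_edge, tv_index_right).

Definition incidence_mx (R : realType) (G : sgraph) : 'M[R]_(#|G|, #|edge G|) :=
  \matrix_(i, j) (enum_val i \in val (enum_val j : edge G))%:R.

(** The block of [x - A_alpha] of the join on the total graph; [k] is the order of the right factor,
    which raises the degrees of the original vertices. *)
Definition total_block (R : realType) (a x : R) (G : sgraph) (k : nat) :
    'M[R]_(#|G| + #|edge G|) :=
  block_mx
    (\matrix_(i, j) ((x - a * ((degree (enum_val i)).*2 + k)%:R) *+ (i == j)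
                     - (1 - a) * (adj (enum_val i) (enum_val j))%:R))
    (- (1 - a) *: incidence_mx R G)
    (- (1 - a) *: (incidence_mx R G)^T)
    (\matrix_(i, j)
       ((x - a * (@degree (total_graph G) (inr (enum_val i : edge G)))%:R)
          *+ (i == j)
        - (1 - a) * (@total_adj G (inr (enum_val i)) (inr (enum_val j)))%:R)).

Definition vertex_col (R : realType) (G : sgraph) : 'cV[R]_(#|G| + #|edge G|) :=
  col_mx (const_mx 1) 0.

Lemma tvjoin_block (R : realType) (a x : R) (G H : sgraph) :
  (\matrix_(i, j) ((x - a * (degree (@tv_index G H i))%:R)
                     *+ (tv_index i == tv_index j)
                   - (1 - a) * (adj (@tv_index G H i) (tv_index j))%:R))
  = block_mx (total_block a x G #|H|)
      (- (1 - a) *: (vertex_col R G *m (const_mx 1 : 'rV_#|H|)))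
      (- (1 - a) *: ((const_mx 1 : 'cV_#|H|) *m (vertex_col R G)^T))
      ((x - a * #|G|%:R)%:M - Aalpha_mx a H).
Proof.
have inj_tv := bij_inj (tv_index_bij G H).
apply/matrixP => i j; rewrite mxE (inj_eq inj_tv).
case: (split_ordP i) => {i} i ->; case: (split_ordP j) => {j} j ->;
  rewrite ?(block_mxEul, block_mxEur, block_mxEdl, block_mxEdr) eq_shift.
- case: (split_ordP i) => {i} i ->; case: (split_ordP j) => {j} j ->;
    rewrite ?(block_mxEul, block_mxEur, block_mxEdl, block_mxEdr) eq_shift;
    rewrite !tv_indexE !mxE ?mulr0n ?sub0r ?mulNr // tvjoin_degree_total.
    by rewrite total_degree_vertex.
  by rewrite addn0.
- rewrite !mxE big_ord1; case: (split_ordP i) => {i} i ->;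
    by rewrite !tv_indexE ?col_mxEu ?col_mxEd !mxE /= ?mulr0n ?mulr1n sub0r
      ?(mulr0, mul0r, mulr1, oppr0).
- rewrite !mxE big_ord1; case: (split_ordP j) => {j} j ->;
    by rewrite !tv_indexE mxE mxE ?col_mxEu ?col_mxEd !mxE /= ?mulr0n ?mulr1n
      sub0r ?(mulr0, mul0r, mulr1, oppr0).
- rewrite !tv_indexE tvjoin_degree_right !mxE natrD /=.
  by case: eqVneq => [->|_]; rewrite ?mulr1n ?mulr0n; ring.
Qed.

(** * Dependence on the right factor *)

Definition coronal_value (R : realType) n (M : 'M[R]_n) (y : R) : R :=
  ((const_mx 1 : 'rV_n) *m invmx (y%:M - M) *m (const_mx 1 : 'cV_n)) 0 0.

Lemma char_poly_tvjoin (R : realType) (a x : R) (G H : sgraph) :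
  (char_poly (Aalpha_mx a H)).[x - a * #|G|%:R] != 0 ->
  (char_poly (Aalpha_mx a (tvjoin G H))).[x]
  = (char_poly (Aalpha_mx a H)).[x - a * #|G|%:R]
    * \det (total_block a x G #|H|
             - ((1 - a) ^+ 2
                * coronal_value (Aalpha_mx a H) (x - a * #|G|%:R))
               *: (vertex_col R G *m (vertex_col R G)^T)).
Proof.
rewrite [in X in X -> _]horner_char_poly => nz.
rewrite (horner_char_poly_Aalpha _ _ (tv_index_bij G H)) tvjoin_block.
by rewrite det_join_block ?unitmxE ?unitfE // horner_char_poly.
Qed.

(** By the adjugate formula, the coronal and its values have a common polynomial numerator over the
    characteristic polynomial; equal denominators then force equal numerators. *)
Lemma coronal_valueE (R : realType) m n (M : 'M[R]_m) (N : 'M[R]_n) (y : R) :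
  coronal M = coronal N -> char_poly M = char_poly N ->
  (char_poly M).[y] != 0 -> coronal_value M y = coronal_value N y.
Proof.
pose num k (A : 'M[R]_k) : {poly R} :=
  ((const_mx 1 : 'rV_k) *m \adj (char_poly_mx A) *m (const_mx 1 : 'cV_k)) 0 0.
have coronalE k (A : 'M[R]_k) :
    coronal A = tofrac (num _ A) / tofrac (char_poly A).
  rewrite /coronal; set S := char_poly_mx A; set p := tofrac (char_poly A).
  have detS : \det (map_mx (@tofrac _) S) = p by rewrite det_map_mx.
  have uS : map_mx (@tofrac _) S \in unitmx.
    by rewrite unitmxE detS unitfE tofrac_eq0 monic_neq0 ?char_poly_monic.
  rewrite /invmx uS detS -scalemxAr -scalemxAl mxE mulrC; congr (_ / _).
  have one m' n' : (const_mx 1 : 'M_(m', n'))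
                   = map_mx (@tofrac {poly R}) (const_mx 1).
    by rewrite map_const_mx rmorph1.
  by rewrite !one -map_mx_adj -!map_mxM mxE.
have valueE k (A : 'M[R]_k) : (char_poly A).[y] != 0 ->
    coronal_value A y = (num _ A).[y] / (char_poly A).[y].
  rewrite horner_char_poly /coronal_value; set S := y%:M - A => nz.
  have uS : S \in unitmx by rewrite unitmxE unitfE.
  rewrite /invmx uS -scalemxAr -scalemxAl mxE mulrC; congr (_ / _).
  have -> : S = map_mx (horner_eval y) (char_poly_mx A).
    apply/matrixP => i j; rewrite !mxE /= /horner_eval !hornerE.
    by rewrite hornerMn hornerX.
  have one m' n' : (const_mx 1 : 'M[R]_(m', n'))
                   = map_mx (horner_eval y) (const_mx 1).
    by rewrite map_const_mx rmorph1.
  by rewrite !one -map_mx_adj -!map_mxM mxE.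
move=> eq_cor eq_char nz; rewrite !valueE -?eq_char //.
congr (_.[y] / _); apply/eqP; rewrite -tofrac_eq; apply/eqP.
move: eq_cor; rewrite !coronalE eq_char => /divIf; apply.
by rewrite tofrac_eq0 monic_neq0 ?char_poly_monic.
Qed.

Lemma char_poly_tvjoin_right (R : realType) (a : R) (G H1 H2 : sgraph) :
  coronal (Aalpha_mx a H1) = coronal (Aalpha_mx a H2) ->
  char_poly (Aalpha_mx a H1) = char_poly (Aalpha_mx a H2) ->
  char_poly (Aalpha_mx a (tvjoin G H1)) = char_poly (Aalpha_mx a (tvjoin G H2)).
Proof.
move=> eq_cor eq_char.
have eq_size := eq_char_poly_size eq_char.
(* At [x], this polynomial has the value of the characteristic polynomial of [H1] at [x - a * #|G|],
   which must not vanish. *)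
apply: (@eq_poly_off_roots _ _ _
         (char_poly (Aalpha_mx a H1 + (a * #|G|%:R)%:M))).
  by rewrite monic_neq0 ?char_poly_monic.
move=> x; rewrite rootE horner_char_poly opprD addrCA -raddfB.
rewrite addrC -horner_char_poly => nz.
rewrite !char_poly_tvjoin -?eq_char // (coronal_valueE eq_cor) //.
by congr (_ * \det (total_block _ _ _ _ - _)).
Qed.

(** * Dependence on a regular left factor *)

Lemma sum_enum_val (V : nmodType) (T : finType) (F : T -> V) :
  \sum_x F x = \sum_(i < #|T|) F (enum_val i).
Proof. by rewrite -big_enum_val. Qed.

(** The line graph has adjacency matrix [N^T N - 2], whence the summand [(1 - a) * 2] in the last
    block. *)
Lemma regular_total_block (R : realType) (a x g : R) (G : sgraph) (r k : nat) :
  (forall v : G, degree v = r) ->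
  total_block a x G k - g *: (vertex_col R G *m (vertex_col R G)^T)
  = block_mx ((x - a * (r + k)%:R)%:M - Aalpha_mx a G - g *: const_mx 1)
             (- (1 - a) *: incidence_mx R G)
             (- (1 - a) *: (incidence_mx R G)^T)
             ((x - a * r.*2%:R + (1 - a) * 2)%:M
              - (1 - a) *: ((incidence_mx R G)^T *m incidence_mx R G)).
Proof.
move=> degG; rewrite /total_block tr_col_mx mul_col_row scale_block_mx.
rewrite opp_block_mx add_block_mx trmx0 !mulmx0 !mul0mx !scaler0 !oppr0 !addr0.
congr block_mx; apply/matrixP => i j; rewrite !mxE.
  rewrite big_ord1 !mxE !degG -addnn !natrD.
  by case: eqVneq => _; rewrite ?mulr1n ?mulr0n; ring.
rewrite (total_degree_edge _ degG).
have -> : \sum_j0 (incidence_mx R G)^T i j0 * incidence_mx R G j0 j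
        = (#|val (enum_val i : edge G) :&: val (enum_val j : edge G)|)%:R.
  rewrite -sum1_card natr_sum [RHS]big_mkcond [RHS]sum_enum_val.
  apply: eq_bigr => v _; rewrite !mxE inE.
  by do 2!case: (_ \in _); rewrite ?mulr1 ?mulr0.
rewrite cardI_edge -!addnn !natrD (inj_eq enum_val_inj).
by case: eqVneq => _; rewrite ?mulr1n ?mulr0n; ring.
Qed.

(** Combines [N N^T = r + A] with [A_alpha = a r + (1 - a) A]. *)
Lemma incidence_mxM (R : realType) (a : R) (G : sgraph) (r : nat) :
  (forall v : G, degree v = r) ->
  (1 - a) *: (incidence_mx R G *m (incidence_mx R G)^T)
  = Aalpha_mx a G + ((1 - a - a) * r%:R)%:M.
Proof.
move=> degG; apply/matrixP => i j; rewrite !mxE.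
have -> : \sum_j0 incidence_mx R G i j0 * (incidence_mx R G)^T j0 j
        = (degree (enum_val i) * (enum_val i == enum_val j)
           + adj (enum_val i) (enum_val j))%:R.
  rewrite -sum_incident2 natr_sum [RHS]sum_enum_val /=.
  apply: eq_bigr => e _; rewrite !mxE.
  by do 2!case: (_ \in _); rewrite ?mulr1 ?mulr0.
rewrite degG natrD natrM (inj_eq enum_val_inj).
by case: eqVneq => _; rewrite ?mulr1n ?mulr0n; ring.
Qed.

Lemma Aalpha_const (R : realType) (a : R) (G : sgraph) (r : nat) :
  (forall v : G, degree v = r) ->
  Aalpha_mx a G *m (const_mx 1 : 'M_#|G|) = r%:R *: const_mx 1.
Proof.
move=> degG; apply/matrixP => i j; rewrite !mxE.
have degE : r%:R = \sum_(j0 < #|G|) (adj (enum_val i) (enum_val j0))%:R :> R.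
  by rewrite -(degG (enum_val i)) degreeE natr_sum sum_enum_val.
transitivity (\sum_(k < #|G|) (a * r%:R *+ (i == k)
                      + (1 - a) * (adj (enum_val i) (enum_val k))%:R)).
  by apply: eq_bigr => k _; rewrite !mxE degG; case: eqVneq => _;
    rewrite ?mulr1n ?mulr0n; ring.
rewrite big_split /= -big_distrr /= -degE (bigD1 i) //= eqxx big1 => [|k].
  by rewrite mulr1n addr0; ring.
by rewrite eq_sym => /negPf->.
Qed.

Lemma char_poly_tvjoin_left (R : realType) (a : R) (G1 G2 H : sgraph)
    (r : nat) :
  (forall v : G1, degree v = r) -> (forall v : G2, degree v = r) ->
  char_poly (Aalpha_mx a G1) = char_poly (Aalpha_mx a G2) ->
  char_poly (Aalpha_mx a (tvjoin G1 H)) = char_poly (Aalpha_mx a (tvjoin G2 H)).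
Proof.
move=> deg1 deg2 eq_char.
have eq_size := eq_char_poly_size eq_char.
have eq_edges : #|edge G1| = #|edge G2|.
  apply: double_inj; rewrite -!handshake (eq_bigr _ (fun v _ => deg1 v)).
  by rewrite (eq_bigr _ (fun v _ => deg2 v)) !sum_nat_const eq_size.
(* In [det_incidence_block], [f] equals [(q - s - r) * (p - r) - t * (r + s)]; as polynomials in [x]
   the two factors are ['X - c1] and ['X - c2], and [c3] is the last term. The roots of [dH], [dQ]
   and [dF] are the points where a required inverse may fail to exist. *)
pose c1 := a * r.*2%:R - (1 - a) * 2 + (1 - a - a) * r%:R + r%:R.
pose c2 := a * (r + #|H|)%:R + r%:R.
pose c3 := (1 - a) * (r%:R + (1 - a - a) * r%:R).
pose dH := char_poly (Aalpha_mx a H + (a * #|G1|%:R)%:M).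
pose dQ : {poly R} := 'X - (a * r.*2%:R - (1 - a) * 2)%:P.
pose dF : {poly R} := ('X - c1%:P) * ('X - c2%:P) - c3%:P.
have nz_dF : dF != 0.
  rewrite /dF subr_eq0; apply/eqP => /(congr1 (fun p : {poly R} => size p)).
  rewrite size_mul ?polyXsubC_eq0 // !size_XsubC size_polyC.
  by case: (c3 != 0).
apply: (@eq_poly_off_roots _ _ _ (dH * dQ * dF)).
  rewrite mulf_neq0 // mulf_neq0 ?polyXsubC_eq0 //.
  by rewrite monic_neq0 ?char_poly_monic.
move=> x; rewrite !rootM !negb_or -!andbA => /and3P[].
rewrite !rootE horner_char_poly opprD addrCA -raddfB addrC -horner_char_poly.
rewrite !hornerE => nzH nzQ nzF.
have eq_y : x - a * #|G2|%:R = x - a * #|G1|%:R by rewrite eq_size.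
rewrite !char_poly_tvjoin ?eq_y //; congr (_ * _).
rewrite (regular_total_block _ _ _ _ deg1) (regular_total_block _ _ _ _ deg2).
set g := _ ^+ 2 * _; set p := x - _; set q := x - _ + _.
pose s := (1 - a - a) * r%:R : R.
pose f := r%:R ^+ 2 - (q - s + p + (1 - a)) * r%:R
          + ((q - s) * p - (1 - a) * s).
have nzq : q != 0.
  by apply: contra nzQ => /eqP q0; apply/eqP; rewrite -[RHS]q0 /q; ring.
have nzf : f != 0.
  apply: contra nzF => /eqP f0; apply/eqP; rewrite -[RHS]f0 /f /q /p /s.
  by rewrite /c1 /c2 /c3; ring.
apply: (mulIf (expf_neq0 #|G1| nzq)); rewrite [in RHS]eq_size.
rewrite (det_incidence_block _ (incidence_mxM a deg1)
           (Aalpha_const a deg1) nzq nzf).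
rewrite (det_incidence_block _ (incidence_mxM a deg2)
           (Aalpha_const a deg2) nzq nzf).
rewrite eq_edges -!scaleNr (eq_char_poly_det_quadratic _ _ eq_char).
by rewrite eq_size.
Qed.

(** The degree is an eigenvalue, with constant eigenvector, and [0 <= a <= 1] makes all entries
    nonnegative, so that the row sum bounds every eigenvalue. Used both ways, this shows that the
    spectrum determines the degree. *)
Lemma regular_char_poly_le (R : realType) (a : R) (G1 G2 : sgraph)
    (r1 r2 : nat) :
  0 <= a <= 1 -> (0 < #|G1|)%N ->
  (forall v : G1, degree v = r1) -> (forall v : G2, degree v = r2) ->
  char_poly (Aalpha_mx a G1) = char_poly (Aalpha_mx a G2) -> (r1 <= r2)%N.
Proof.
move=> /andP[a_ge0 a_le1] n_gt0 deg1 deg2 eq_char.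
have : eigenvalue (Aalpha_mx a G1) r1%:R.
  pose i := Ordinal n_gt0; apply/eigenvalueP.
  exists (row i (const_mx 1)); last first.
    by apply/rV0Pn; exists i; rewrite !mxE oner_eq0.
  rewrite -row_mul; have -> : const_mx 1 *m Aalpha_mx a G1
                            = r1%:R *: const_mx 1 :> 'M_#|G1|.
    apply: trmx_inj; rewrite trmx_mul trmx_Aalpha trmx_const.
    by rewrite (Aalpha_const a deg1) linearZ /= trmx_const.
  by rewrite linearZ.
rewrite eigenvalue_root_char eq_char -eigenvalue_root_char => /eigenvalueP[v].
move=> vB /rV0Pn[i0 vi0].
(* An entry of [v] of maximal modulus bounds the eigenvalue by a row sum. *)
case: (@Order.TotalTheory.arg_maxP _ _ _ i0 xpredT (fun i => `|v 0 i|)) => //.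
move=> i _ maxi.
have vi_gt0 : 0 < `|v 0 i|.
  by apply: lt_le_trans (maxi i0 isT); rewrite normr_gt0.
rewrite -(ler_nat R) -(ler_pM2r vi_gt0) -[r1%:R]ger0_norm ?ler0n // -normrM.
have -> : r1%:R * v 0 i = (v *m Aalpha_mx a G2) 0 i by rewrite vB mxE.
have -> : r2%:R = \sum_j Aalpha_mx a G2 i j.
  have /matrixP/(_ i i) := Aalpha_const a deg2; rewrite !mxE mulr1 => <-.
  by apply: eq_bigr => j _; rewrite [const_mx _ _ _]mxE mulr1.
have B_ge0 j : 0 <= Aalpha_mx a G2 i j.
  rewrite !mxE addr_ge0 ?mulr_ge0 ?ler0n ?subr_ge0 //.
  by rewrite mulrn_wge0 ?ler0n.
rewrite mxE mulr_suml; apply: le_trans (ler_norm_sum _ _ _) _.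
apply: ler_sum => j _; rewrite -[in _ j i]trmx_Aalpha mxE mulrC normrM.
by rewrite ger0_norm // ler_wpM2l //; apply: maxi.
Qed.

Theorem corollary5p3 (R : realType) (alpha : R) (halpha : 0 <= alpha <= 1) :
  (forall G1 G2 H : sgraph,
     regular G1 -> regular G2 ->
     Aalpha_cospectral alpha G1 G2 ->
     Aalpha_cospectral alpha (tvjoin G1 H) (tvjoin G2 H))
  /\
  (forall G H1 H2 : sgraph,
     regular G ->
     coronal (Aalpha_mx alpha H1) = coronal (Aalpha_mx alpha H2) ->
     Aalpha_cospectral alpha H1 H2 ->
     Aalpha_cospectral alpha (tvjoin G H1) (tvjoin G H2)).
Proof.
have eq_char (G H : sgraph) : Aalpha_cospectral alpha G H ->
    char_poly (Aalpha_mx alpha G) = char_poly (Aalpha_mx alpha H).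
  by case=> _; apply: eq_spectrum_char_poly; apply: trmx_Aalpha.
split=> [G1 G2 H [r deg1] [r2 deg2] cosp|G H1 H2 [r degG] eq_cor cosp];
  have [niso _] := cosp.
- have eqG := eq_char _ _ cosp; have eq_card := eq_char_poly_size eqG.
  (* An empty graph is regular of every degree, so the degrees are compared at a given vertex. *)
  have {}deg2 x : @degree G2 x = r.
    have n2_gt0 : (0 < #|G2|)%N by apply/card_gt0P; exists x.
    have n1_gt0 : (0 < #|G1|)%N by rewrite eq_card.
    rewrite deg2; apply/eqP; rewrite eqn_leq.
    rewrite (regular_char_poly_le halpha n1_gt0 deg1 deg2 eqG).
    by rewrite (regular_char_poly_le halpha n2_gt0 deg2 deg1 (esym eqG)).
  split=> [iso|x]; last first.
    by rewrite /spectrum (char_poly_tvjoin_left H deg1 deg2).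
  (* If [H] is empty, degrees do not separate vertices from edges, and the total graphs themselves
     are compared. *)
  apply: niso; have [H0|H_gt0] := posnP #|H|.
    exact: total_graph_cancel deg1 deg2 eq_card (tvjoin_empty_cancel H0 iso).
  exact: tvjoin_left_cancel deg1 deg2 eq_card H_gt0 iso.
- have eqH := eq_char _ _ cosp; have eq_card := eq_char_poly_size eqH.
  split=> [iso|x]; last first.
    by rewrite /spectrum (char_poly_tvjoin_right G eq_cor eqH).
  exact/niso/(tvjoin_right_cancel degG eq_card iso).
Qed.
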